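(* Let $A,B\subset\mathbb R$ be bounded measurable sets of finite measure, let $c>0$, and put $K_{A,B,c}=P_{cB}\mathcal FP_A$, $S_{A,B,c}=K_{A,B,c}^*K_{A,B,c}$, $m=c|A||B|$ and $\zeta=\frac{\pi c}{2}\operatorname{diam}_{\mathrm{ess}}(A)\operatorname{diam}_{\mathrm{ess}}(B)$. Choose essential centres $\alpha_0,\beta_0$ of $A,B$. For every $N\ge1$ choose centres $\alpha_N,\beta_N$ that minimize $a\mapsto\int_A|x-a|^{2N}dx$ and $b\mapsto\int_B|\eta-b|^{2N}d\eta$, respectively; at $N=0$ the moment centres are arbitrary. Put, for $N\in\mathbb N_0$, $$\mathfrak R_N:=\min\bigl\{\mathcal R_N(\alpha_0,\beta_0),\ \mathcal R_N(\alpha_N,\beta_N)\bigr\},\qquad \widehat E_N:=\min\left\{E_N^{\mathrm{mom}},\ \sqrt m\,\chi_N(\zeta)\right\}.$$ Then $$\mathfrak R_N\le\widehat E_N\le\sqrt m\,\frac{\zeta^N}{N!}\qquad(N\in\mathbb N_0).$$ For every $0<\epsilon<1/2$, $$\Lambda_\epsilon(S_{A,B,c})\le\min_{N\in\mathbb N_0}\left[N+\kappa\!\left(\frac{\mathfrak R_N^2}{\epsilon}\right)\right]\le\min_{N\in\mathbb N_0}\left[N+\kappa\!\left(\frac{\widehat E_N^2}{\epsilon}\right)\right]\le\min_{N\in\mathbb N_0}\left[N+\kappa\!\left(\frac{m\,\chi_N(\zeta)^2}{\epsilon}\right)\right].$$ Each minimum is finite. Moreover, every one of these three minima is no larger than $$\mathcal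 N_{\mathrm{fac}}(m,\zeta,\epsilon):=\min\left\{N\in\mathbb N_0:\ \sqrt m\,\frac{\zeta^N}{N!}\le\sqrt\epsilon\right\}.$$
   Context: $P_E$ is multiplication by the indicator of $E$ on $L^2(\mathbb R)$; $(\mathcal Ff)(\xi)=\int_{\mathbb R}e^{-2\pi i x\xi}f(x)\,dx$. For a positive contraction $S$, $\Lambda_\epsilon(S):=\operatorname{rank}\mathbf 1_{(\epsilon,1-\epsilon)}(S)$. For $r\ge0$, $\kappa(r):=\max\{0,\lceil r\rceil-1\}$. $\operatorname{diam}_{\mathrm{ess}}(E):=\operatorname{ess\,sup}_{x,y\in E}|x-y|$ ($0$ for null sets); $\zeta^0=1$. An essential centre of a bounded set $E$ of positive measure is the midpoint of $[\operatorname{ess\,inf}E,\operatorname{ess\,sup}E]$; for a null set it may be chosen arbitrarily. For $\alpha,\beta\in\mathbb R$ let $t_{\alpha,\beta}(x,\xi):=2\pi(x-\alpha)(\xi-c\beta)$; let $\mathcal P_{N-1}$ be the complex polynomials of degree at most $N-1$ for $N\ge1$ and $\mathcal P_{-1}=\{0\}$; and define $\mathcal R_N(\alpha,\beta)\ge0$ by $$\mathcal R_N(\alpha,\beta)^2:=\min_{p\in\mathcal P_{N-1}}\int_A\int_{cB}\left|e^{-it_{\alpha,\beta}(x,\xi)}-p\bigl(t_{\alpha,\beta}(x,\xi)\bigr)\right|^2d\xi\,dx.$$ With the convention $|x-a|^0=1$, $$E_N^{\mathrm{mom}}:=\frac{(2\pi c)^N\sqrt c}{N!}\left(\inf_{a\in\mathbb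 R}\int_A|x-a|^{2N}dx\ \inf_{b\in\mathbb R}\int_B|\eta-b|^{2N}d\eta\right)^{1/2}.$$ With $J_k$ the Bessel function of the first kind, $$\chi_0(\zeta):=1,\qquad \chi_N(\zeta):=\min\left\{1,\ \frac{\zeta^N}{N!},\ 2\sum_{k=N}^\infty|J_k(\zeta)|\right\}\quad(N\ge1).$$ *)

(* Defs.v *)
From HB Require Import structures.
From mathcomp Require Import all_boot all_order all_algebra.
From mathcomp Require Import all_classical all_reals all_analysis.
From mathcomp Require Import ess_sup_inf.
From mathcomp Require Import complex.

Set Implicit Arguments.
Unset Strict Implicit.
Unset Printing Implicit Defensive.

Import Order.TTheory GRing.Theory Num.Theory.
Import numFieldNormedType.Exports.

Local Open Scope classical_set_scope.
Local Open Scope ring_scope.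
Local Open Scope complex_scope.

(* The measure is the completed one, so that "measurable" below means Lebesgue
   measurable; `measurable X` for X : set R would only mean Borel. *)
Notation leb := completed_lebesgue_measure.

Notation lebesgue_type R :=
  (caratheodory_type (lebesgue_stieltjes_measure.wlength (R := R) idfun)^*%mu).

Section Lebesgue.
Variable R : realType.

Definition lebesgue_measurable (D : set R) : Prop :=
  measurable (D : set (lebesgue_type R)).

Definition lebesgue_measurable_fun (f : R -> R) : Prop :=
  measurable_fun setT (f : lebesgue_type R -> R).

Definition lint (D : set R) (f : R -> \bar R) : \bar R :=
  (\int[leb]_(x in D) f x)%E.

Definition vol (D : set R) : R := fine (leb D).

Definition ae_equal (f g : R -> R[i]) : Prop :=
  \forall x \ae leb, f x = g x.

(* Values off the set are -oo (resp. +oo) and so do not contribute; on a null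
   set the results are -oo and +oo, which `fine` sends to 0. *)
Definition esssup_of (D : set R) : R :=
  fine (ess_sup leb (fun x : R => if x \in D then x%:E else -oo%E)).

Definition essinf_of (D : set R) : R :=
  fine (ess_inf leb (fun x : R => if x \in D then x%:E else +oo%E)).

Definition diam_ess (D : set R) : R :=
  fine (ess_sup (leb \x leb)%E (fun z : R * R =>
    if (z.1 \in D) && (z.2 \in D) then `|z.1 - z.2|%:E else -oo%E)).

Definition is_ess_centre (D : set R) (a : R) : Prop :=
  leb D != 0%E -> a = (essinf_of D + esssup_of D) / 2.

End Lebesgue.

(* Elements of L^2(R) are represented by functions R -> R[i], and identities
   between them hold almost everywhere. *)
Section L2.
Variable R : realType.
Notation C := R[i].

Definition normsq (z : C) : R := complex.Re z ^+ 2 + complex.Im z ^+ 2.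

Definition cis (t : R) : C := cos t +i* sin t.

Definition cint (D : set R) (f : R -> C) : C :=
  fine (lint D (fun x => (complex.Re (f x))%:E))
  +i* fine (lint D (fun x => (complex.Im (f x))%:E)).

Definition L2 (f : R -> C) : Prop :=
  [/\ lebesgue_measurable_fun (fun x => complex.Re (f x)),
      lebesgue_measurable_fun (fun x => complex.Im (f x))
    & (lint setT (fun x => (normsq (f x))%:E) < +oo)%E].

Definition inner (f g : R -> C) : C :=
  cint setT (fun x => f x * conjc (g x)).

Definition operator := (R -> C) -> R -> C.

Definition is_adjoint (T T' : operator) : Prop :=
  (forall f, L2 f -> L2 (T' f)) /\
  (forall f g, L2 f -> L2 g -> inner (T f) g = inner f (T' g)).

(* The dimension of the range T(L^2), as the supremum of the sizes of linearly
   independent families in it; +oo if T has infinite rank. *)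
Definition oprank (T : operator) : \bar R :=
  ereal_sup [set n%:R%:E | n in [set n : nat |
    exists2 f : 'I_n -> R -> C, (forall i, L2 (f i)) &
      forall a : 'I_n -> C,
        ae_equal (fun x => \sum_(i < n) a i * T (f i) x) (fun=> 0) ->
        forall i, a i = 0]].

(* E is the spectral measure of the bounded self-adjoint operator S: a
   compactly supported projection-valued measure on the Borel sets of the line
   with S = \int t dE(t).  Countable additivity and the integral are expressed
   through the scalar measures X |-> <E(X)f, f>. *)
Record spectral_measure_of (S : operator) (E : set R -> operator) : Prop := {
  spectral_L2 : forall X f, measurable X -> L2 f -> L2 (E X f);
  spectral_linear : forall X (a : C) f g, measurable X -> L2 f -> L2 g ->
    ae_equal (E X (fun x => a * f x + g x)) (fun x => a * E X f x + E X g x);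
  spectral_selfadjoint : forall X f g, measurable X -> L2 f -> L2 g ->
    inner (E X f) g = inner f (E X g);
  spectral_setI : forall X Y f, measurable X -> measurable Y -> L2 f ->
    ae_equal (E (X `&` Y) f) (E X (E Y f));
  spectral_setT : forall f, L2 f -> ae_equal (E setT f) f;
  spectral_bounded : exists M : R,
    forall f, L2 f -> ae_equal (E `[- M, M]%classic f) f;
  spectral_integral : forall f, L2 f ->
    exists nu : {finite_measure set (measurableTypeR R) -> \bar R},
      (forall X, measurable X -> inner (E X f) f = (fine (nu X))%:C) /\
      inner (S f) f = (fine (\int[nu]_t t%:E)%E)%:C
}.

(* rank 1_(eps, 1 - eps)(S), for E the spectral measure of S *)
Definition Lambda (eps : R) (E : set R -> operator) : \bar R :=
  oprank (E `]eps, 1 - eps[%classic).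

Definition proj (D : set R) : operator :=
  fun f x => if x \in D then f x else 0.

(* The integral formula, used below only on P_A f with A bounded, which is
   integrable whenever f is in L^2. *)
Definition fourier : operator :=
  fun f xi => cint setT (fun x => cis (- (2 * pi * x * xi)) * f x).

Definition dilate (c : R) (B : set R) : set R := [set c * b | b in B].

Definition K (A B : set R) (c : R) : operator :=
  fun f => proj (dilate c B) (fourier (proj A f)).

End L2.

Section Quantities.
Variable R : realType.
Implicit Types (A B D : set R) (c zeta : R) (N : nat).

Definition kappa (r : R) : nat := absz (Num.max 0 (Num.ceil r - 1)%R)%R.

Definition phase c (alpha beta x xi : R) : R :=
  2 * pi * (x - alpha) * (xi - c * beta).

(* `size p <= N` says deg p <= N - 1, and p = 0 when N = 0. *)
Definition poly_remainder A B c N (alpha beta : R) : R :=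
  Num.sqrt (fine (ereal_inf [set
    lint A (fun x => lint (dilate c B) (fun xi =>
      (normsq (cis (- phase c alpha beta x xi)
               - p.[(phase c alpha beta x xi)%:C]))%:E))
    | p in [set p : {poly R[i]} | (size p <= N)%N]])).

Definition moment D N (a : R) : \bar R :=
  lint D (fun x => (`|x - a| ^+ (2 * N))%:E).

Definition minimizes (F : R -> \bar R) (a : R) : Prop :=
  forall b, (F a <= F b)%E.

Definition E_mom A B c N : R :=
  (2 * pi * c) ^+ N * Num.sqrt c / N`!%:R *
  Num.sqrt (fine (ereal_inf (range (moment A N)))
            * fine (ereal_inf (range (moment B N)))).

Definition besselJ (k : nat) (x : R) : R :=
  limn (series (fun j : nat =>
    (-1) ^+ j / (j`!%:R * (j + k)`!%:R) * (x / 2) ^+ (2 * j + k))).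

Definition chi N zeta : R :=
  if N == 0%N then 1 else
  fine (Order.min 1%:E (Order.min (zeta ^+ N / N`!%:R)%:E
    (2%:E * \sum_(N <= k <oo) `|besselJ k zeta|%:E)))%E.

End Quantities.

Definition is_least (P : nat -> Prop) (n : nat) : Prop :=
  P n /\ forall k, P k -> (n <= k)%N.

Definition is_min (F : nat -> nat) (n : nat) : Prop :=
  is_least (fun k => exists N, F N = k) n.

(* Main.v *)
(* The kernel of K is, up to unimodular factors in x and in xi, exp(-i t) with
   t = 2 pi (x - alpha)(xi - c beta).  For a polynomial p of degree below N the
   kernel with p(t) in place of exp(-i t) has rank at most N, its functions of x
   spanning a space W that does not depend on p.  If the range of
   1_(eps, 1 - eps)(S) contains n independent vectors, it contains an orthonormal
   family e_1, ..., e_d orthogonal to W with d >= n - N.  There |K e_i|^2 > eps,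
   while Bessel's inequality applied for each xi to the remainder
   exp(-i t) - p(t) bounds the sum of the |K e_i|^2 by its squared L^2 norm.
   Hence d < R_N^2 / eps, i.e. d <= kappa(R_N^2 / eps).

   R_N is estimated by explicit polynomials: the Taylor polynomial, which gives
   a product of moments, and, for |t| <= zeta, the truncated Jacobi-Anger
   expansion, i.e. the Chebyshev expansion of exp(-i zeta cos th). *)

Require Import Defs.
From HB Require Import structures.
From mathcomp Require Import all_boot all_order all_algebra.
From mathcomp Require Import all_classical all_reals all_analysis.
From mathcomp Require Import measurable_realfun ess_sup_inf complex spectral sesquilinear ring lra.

Set Implicit Arguments.
Unset Strict Implicit.
Unset Printing Implicit Defensive.

Import Order.TTheory GRing.Theory Num.Theory.
Import numFieldNormedType.Exports.

Local Open Scope classical_set_scope.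
Local Open Scope ring_scope.
Local Open Scope complex_scope.

(** Two estimates of the remainder compete, and each has its own centres: |t| <= zeta holds almost
    everywhere about the essential centres, from which almost every point is at most half a diameter
    away, while the product of moments is smallest about the moment centres. The rank bound holds
    for every pair of centres, so both pairs may be used and the smaller remainder kept.

    A vector in the range of the spectral projection has its scalar spectral measure on the set
    where t > eps. This gives a strict inequality for each e_i, and strictness is the reason for
    ceil(r) - 1, rather than floor(r), in [kappa].

    The Jacobi-Anger expansion is reached from the Taylor polynomial of exp(-i t): its finite double
    sums can be rearranged freely, and limits are taken only in the resulting error estimate.

    Identities in L^2 hold almost everywhere, but the truncated Fourier operator sees a function
    only through integrals, so representatives can be exchanged inside it. *)

Local Notation nrm := (@Normc.normc _).
Local Notation lebesgue_integrable f :=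
  (leb.-integrable setT (EFin \o (f : lebesgue_type _ -> _))).

(** * Taylor remainder of the exponential *)

Section Taylor.
Variable R : realType.
Notation C := R[i].
Implicit Types (t : R) (w z : C) (N : nat).

Lemma nrm_ge0 z : 0 <= nrm z.
Proof. by case: z => a b; rewrite sqrtr_ge0. Qed.

Lemma normsqE z : normsq z = nrm z ^+ 2.
Proof. by case: z => a b; rewrite sqr_sqrtr// addr_ge0 ?sqr_ge0. Qed.

Lemma normsq_le_sqr z (k : R) : nrm z <= k -> normsq z <= k ^+ 2.
Proof.
move=> zk; rewrite normsqE lerXn2r ?nnegrE ?nrm_ge0//.
exact: le_trans (nrm_ge0 z) zk.
Qed.

Lemma nrmD z w : nrm (z + w) <= nrm z + nrm w.
Proof. exact: le_normcD. Qed.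

Lemma nrmN z : nrm (- z) = nrm z.
Proof. by case: z => a b; rewrite /= !sqrrN. Qed.

Lemma nrmM z w : nrm (z * w) = nrm z * nrm w.
Proof. exact: Normc.normcM. Qed.

Lemma nrm_real (x : R) : nrm x%:C = `|x|.
Proof. by rewrite /= expr0n addr0 sqrtr_sqr. Qed.

Lemma nrm_cis t : nrm (cis t) = 1.
Proof. by rewrite /= cos2Dsin2 sqrtr1. Qed.

Lemma nrm_sum I (r : seq I) (P : pred I) (F : I -> C) :
  nrm (\sum_(i <- r | P i) F i) <= \sum_(i <- r | P i) nrm (F i).
Proof.
apply: (big_ind2 (fun z x => nrm z <= x)) => //.
  by rewrite Normc.normc0.
by move=> z x w y zx wy; apply: le_trans (nrmD _ _) (lerD _ _).
Qed.

Lemma nrmX z n : nrm (z ^+ n) = nrm z ^+ n.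
Proof.
elim: n => [|n ih]; first by rewrite !expr0 Normc.normc1.
by rewrite !exprS nrmM ih.
Qed.

Lemma nrmJ z : nrm (conjc z) = nrm z.
Proof. by case: z => a b; rewrite /= sqrrN. Qed.

(** The test value conj z / |z| recovers |z| as a real part. This duality reduces a complex estimate
    to real functions, for which monotonicity follows from the sign of a derivative. *)
Lemma nrm_le_support (r : R) z :
  (forall w, nrm w <= 1 -> complex.Re (w * z) <= r) -> nrm z <= r.
Proof.
have [z0 /(_ 0)|z0] := eqVneq (nrm z) 0.
  by rewrite z0 mul0r; apply; rewrite Normc.normc0.
move=> /(_ (conjc z * (nrm z)^-1%:C)).
rewrite nrmM nrmJ nrm_real ger0_norm ?invr_ge0 ?nrm_ge0// mulfV// lexx => /(_ isT).
apply: le_trans.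
rewrite [X in X <= _](_ : _ = nrm z ^+ 2 * (nrm z)^-1); last by field.
rewrite -normsqE; move: (nrm z)^-1 => u; rewrite /normsq.
by case: z {z0} => a b /=; lra.
Qed.

Definition expi_taylor N t : C := \sum_(k < N) (- 'i * t%:C) ^+ k / k`!%:R.

Lemma natrC n : (n%:R : C) = n%:R%:C.
Proof. by rewrite rmorph_nat. Qed.

(* Bounding the modulus amounts to bounding real parts against all [w] in the
   unit disc; [G] is such a real part, and d/dt turns [G N.+1 w] into
   [G N (- 'i * w)], which allows an induction on [N] over the reals. *)
Let G N w t : R :=
  complex.Re w * cos t + complex.Im w * sin t -
  \sum_(k < N) complex.Re (w * (- 'i) ^+ k) / k`!%:R * t ^+ k.

Let G_Re N w t : G N w t = complex.Re (w * (cis (- t) - expi_taylor N t)).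
Proof.
rewrite /G mulrBr raddfB /=; congr (_ - _).
  by case: w => a b /=; rewrite cosN sinN; ring.
rewrite /expi_taylor mulr_sumr raddf_sum; apply: eq_bigr => k _.
rewrite exprMn mulrA natrC -rmorphXn -fmorphV /= mulrA.
by case: (w * _) => a b /=; ring.
Qed.

Let is_derive_mulX (c x : R) n :
  is_derive x 1 (fun y : R => c * y ^+ n) (c * (n%:R * x ^+ n.-1)).
Proof.
rewrite (_ : (fun y => _) = c *: (@id R) ^+ n); last first.
  by apply/funext => y; rewrite /GRing.scale /= exprfctE.
by apply: is_derive_eq; rewrite /GRing.scale /= mulr1.
Qed.

Let dG N w t : is_derive t 1 (G N.+1 w) (G N (- 'i * w) t).
Proof.
rewrite /G.
set F := fun (k : 'I_N.+1) (t : R) => complex.Re (w * (- 'i) ^+ k) / k`!%:R * t ^+ k.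
have dF (k : 'I_N.+1) : is_derive t 1 (F k)
    (complex.Re (w * (- 'i) ^+ k) / k`!%:R * (k%:R * t ^+ k.-1)).
  exact: is_derive_mulX.
have -> : (fun t => complex.Re w * cos t + complex.Im w * sin t
   - \sum_(k < N.+1) complex.Re (w * (- 'i) ^+ k) / k`!%:R * t ^+ k) =
  (complex.Re w *: (@cos R) + complex.Im w *: (@sin R)) - \sum_k F k.
  by apply/funext => x; rewrite /= !fctE fct_sumE.
have D1 := is_deriveD (is_deriveZ (complex.Re w) (is_derive_cos t))
  (is_deriveZ (complex.Im w) (is_derive_sin t)).
apply: (is_derive_eq (is_deriveB D1 (is_derive_sum dF))).
rewrite /GRing.scale/=; congr (_ - _).
  have [-> ->] : complex.Re (- 'i * w) = complex.Im w /\
      complex.Im (- 'i * w) = - complex.Re w.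
    by move: w {F dF D1} => [a b] /=; split; ring.
  by ring.
rewrite big_ord_recl/= mul0r mulr0 add0r; apply: eq_bigr => k _.
rewrite /bump /= add1n /= factS natrM.
have -> : - 'i * w * (- 'i) ^+ k = w * (- 'i) ^+ k.+1 by rewrite exprS; ring.
field; rewrite nat1r !pnatr_eq0 /= andbT.
by rewrite -lt0n fact_gt0.
Qed.

Let G_le N w t : nrm w <= 1 -> 0 <= t -> G N w t <= t ^+ N / N`!%:R.
Proof.
elim: N w t => [|N ih] w t w1 t0.
  rewrite expr0 fact0 divr1 G_Re /expi_taylor big_ord0 subr0.
  apply: (le_trans (ler_norm _)).
  apply: (@le_trans _ _ (nrm (w * cis (- t)))); last by rewrite nrmM nrm_cis mulr1.
  case: (w * _) => a b; rewrite /= -sqrtr_sqr ler_sqrt ?lerDl ?sqr_ge0//.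
  by rewrite addr_ge0 ?sqr_ge0.
(* [H] vanishes at 0, and its derivative is nonpositive by the induction hypothesis at [- 'i * w],
   which is still in the unit disc. *)
pose H t := G N.+1 w t - t ^+ N.+1 / N.+1`!%:R.
have dH (x : R) : is_derive x 1 H (G N (- 'i * w) x - x ^+ N / N`!%:R).
  have dGx := dG N w x; have dX := is_derive_mulX (N.+1`!%:R)^-1 x N.+1.
  rewrite (_ : H = G N.+1 w - (fun y => (N.+1`!%:R)^-1 * y ^+ N.+1)); last first.
    by apply/funext => y; rewrite /H !fctE mulrC [in X in _ - X]mulrC.
  apply: (is_derive_eq (is_deriveB dGx dX)); rewrite factS natrM; congr (_ - _) => /=.
  field; rewrite nat1r !pnatr_eq0 /= andbT.
  by rewrite -lt0n fact_gt0.
have H0 : H 0 = 0.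
  rewrite /H /G cos0 sin0 mulr1 mulr0 addr0 expr0n /= mul0r subr0.
  rewrite big_ord_recl big1 => [|k _]; last by rewrite lift0 expr0n /= mulr0.
  by rewrite !expr0 !mulr1 fact0 divr1 addr0 subrr.
suff : H t <= H 0 by rewrite H0 /H subr_le0.
have [->//|tn0] := eqVneq t 0.
have tp : 0 < t by rewrite lt_def tn0.
apply: (@ler0_derive1_nincr _ H 0 t) => // x.
- rewrite in_itv /= => /andP[/ltW x0 _]; rewrite derive1E (@derive_val _ _ _ _ _ _ _ (dH x)).
  rewrite subr_le0 ih//.
  rewrite nrmM (_ : nrm (- 'i) = 1) ?mul1r//.
  by rewrite /= oppr0 expr0n add0r sqrrN expr1n sqrtr1.
- apply: continuous_subspaceT => y; apply: differentiable_continuous.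
  by apply/derivable1_diffP.
Qed.

Lemma expi_taylor_le N t : nrm (cis (- t) - expi_taylor N t) <= `|t| ^+ N / N`!%:R.
Proof.
wlog t0 : t / 0 <= t => [hw|].
  have [|/ltW t0] := leP 0 t; first exact: hw.
  have := hw (- t); rewrite oppr_ge0 t0 normrN => /(_ isT).
  (* Conjugation turns - i into i, hence exchanges t and - t in both terms. *)
  have <- : conjc (cis (- - t) - expi_taylor N (- t)) = cis (- t) - expi_taylor N t.
    rewrite rmorphB /= opprK; congr (_ - _); first by rewrite /cis /= sinN cosN.
    rewrite /expi_taylor rmorph_sum /=; apply: eq_bigr => k _.
    rewrite rmorphM rmorphXn natrC -fmorphV; congr (_ ^+ _ * _); last exact: conjc_real.
    by apply/eqP; rewrite eq_complex /=; apply/andP; split; apply/eqP; ring.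
  by rewrite nrmJ.
rewrite ger0_norm//; apply: nrm_le_support => w w1.
by rewrite -G_Re; exact: G_le.
Qed.

End Taylor.

(** * Truncation of the Jacobi-Anger expansion *)

Section TriangularSums.
Variable V : nmodType.
Implicit Types (M : nat) (F : nat -> nat -> V).

(** Both sides run over the pairs with a + j < M; on the left they are grouped by the exponent m = a
    + j, as the binomial theorem delivers them. *)
Lemma sum_antidiagonals M F :
  \sum_(m < M) \sum_(j < m.+1) F (m - j)%N j =
  \sum_(j < M) \sum_(a < M - j) F a j.
Proof.
elim: M => [|M ih]; first by rewrite !big_ord0.
rewrite big_ord_recr /= ih [RHS](eq_bigr (fun j : 'I_M.+1 =>
  \sum_(a < M - j) F a j + F (M - j)%N j)) => [|j _]; last first.
  by rewrite subSn ?big_ord_recr//= -ltnS.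
by rewrite big_split /= [in RHS]big_ord_recr /= subnn big_ord0 addr0.
Qed.

(* Pairs of indices grouped by their minimum [j] and their distance [n]. *)
Definition symmetrized F n j : V :=
  if n == 0%N then F j j else F (j + n)%N j + F j (j + n)%N.

(** A pair with minimum j and distance n has sum 2 j + n, hence the range of n. The induction goes
    in steps of two: removing the pairs with a zero index from the triangle of size M + 2 leaves a
    shifted triangle of size M. *)
Lemma sum_triangle_fold M F :
  \sum_(j < M) \sum_(a < M - j) F a j =
  \sum_(j < M) \sum_(n < M - j.*2) symmetrized F n j.
Proof.
elim/ltn_ind: M F => -[|[|M]] ih F; first by rewrite !big_ord0.
  by rewrite !big_ord1.
rewrite !(big_ord_recl M.+1).
have -> : \sum_(i < M.+1) \sum_(a < M.+2 - lift ord0 i) F a (lift ord0 i) =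
  \sum_(i < M.+1) F 0 i.+1 +
  \sum_(i < M.+1) \sum_(a < M - i) F a.+1 i.+1.
  rewrite -big_split /=; apply: eq_bigr => i _.
  by rewrite /bump /= add1n subSS subSn ?big_ord_recl// -ltnS.
have -> : \sum_(i < M.+1) \sum_(n < M.+2 - (lift ord0 i).*2)
    symmetrized F n (lift ord0 i) =
  \sum_(i < M.+1) \sum_(n < M - i.*2) symmetrized (fun a b => F a.+1 b.+1) n i.
  apply: eq_bigr => i _; rewrite /bump /= ?add1n ?doubleS ?subSS.
  by apply: eq_bigr => n _; rewrite /symmetrized addSn.
rewrite [X in _ + (_ + X) = _]big_ord_recr [X in _ = _ + X]big_ord_recr /= subnn big_ord0 addr0.
rewrite (_ : (M - M.*2 = 0)%N) ?big_ord0 ?addr0; last first.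
  by apply/eqP; rewrite subn_eq0 -addnn leq_addr.
rewrite (ih M _ (fun a j => F a.+1 j.+1))// addrA; congr (_ + _).
rewrite -addrA; congr (_ + _); rewrite -big_split /=.
by apply: eq_bigr => i _; rewrite /symmetrized /bump /= add0n.
Qed.

(** Exactly [uphalf (M - n)] values of j satisfy 2 j + n < M. With n outermost, this is the number
    of terms of the Bessel series of order n that the Taylor polynomial of length M contains. *)
Lemma sum_triangle_exchange M F :
  \sum_(j < M) \sum_(n < M - j.*2) F n j =
  \sum_(n < M) \sum_(j < uphalf (M - n)) F n j.
Proof.
have lt_half j n : (n < M - j.*2)%N = (j < uphalf (M - n))%N.
  by rewrite gtn_uphalf_double !ltn_subRL addnC.
transitivity (\sum_(j < M) \sum_(n < M | (n < M - j.*2)%N) F n j).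
  by apply: eq_bigr => j _; rewrite (big_ord_widen _ (F^~ j) (leq_subr _ _)).
transitivity (\sum_(n < M) \sum_(j < M | (j < uphalf (M - n))%N) F n j).
  rewrite (exchange_big_dep predT)//=; apply: eq_bigr => n _.
  by apply: eq_bigl => j; rewrite lt_half.
apply: eq_bigr => n _; rewrite -big_ord_widen//.
by rewrite leq_uphalf_double -addnn (leq_trans (leq_subr _ _))// leq_addr.
Qed.

End TriangularSums.

(** * Bessel series and Chebyshev polynomials *)

Section JacobiAnger.
Variable R : realType.
Notation C := R[i].

Definition bessel_term n (x : R) j : R :=
  (-1) ^+ j / (j`!%:R * (j + n)`!%:R) * (x / 2) ^+ (2 * j + n).

(** From (j + n)! >= n!. The prefactor (x / 2)^n / n! is summable in n, which later makes the high
    orders small whatever the truncation of their series. *)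
Lemma bessel_term_le n x j : 0 <= x ->
  `|bessel_term n x j| <= (x / 2) ^+ n / n`!%:R * exp_coeff ((x / 2) ^+ 2) j.
Proof.
move=> x0; rewrite /bessel_term /exp_coeff /= !normrM normrX normrN1 expr1n mul1r.
rewrite [X in _ * X <= _]ger0_norm ?exprn_ge0 ?divr_ge0//.
rewrite ger0_norm ?invr_ge0 ?mulr_ge0// exprD -exprM.
have n0 k : 0 < k`!%:R :> R by rewrite ltr0n fact_gt0.
rewrite [X in _ <= X](_ : _ =
    (j`!%:R * n`!%:R)^-1 * ((x / 2) ^+ (2 * j) * (x / 2) ^+ n)); last first.
  by rewrite invfM; ring.
rewrite ler_wpM2r ?mulr_ge0 ?exprn_ge0 ?divr_ge0//.
rewrite lef_pV2 ?posrE ?mulr_gt0// ler_pM2l// ler_nat.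
elim: j => [|j ih]; first by rewrite add0n.
by rewrite addSn factS (leq_trans ih)// leq_pmull.
Qed.

Lemma bessel_partial_le n x k : 0 <= x ->
  `|series (bessel_term n x) k| <= (x / 2) ^+ n / n`!%:R * expR ((x / 2) ^+ 2).
Proof.
move=> x0; rewrite /series /=.
apply: (le_trans (ler_norm_sum _ _ _)).
apply: (le_trans (ler_sum _ (fun j _ => bessel_term_le n j x0))).
rewrite -mulr_sumr ler_wpM2l ?divr_ge0 ?exprn_ge0 ?divr_ge0//.
rewrite /expR; apply: nondecreasing_cvgn_le; last exact: is_cvg_series_exp_coeff.
by apply/nondecreasing_series => i _ _; rewrite exp_coeff_ge0 ?sqr_ge0.
Qed.

Lemma is_cvg_bessel n x : 0 <= x -> cvgn (series (bessel_term n x)).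
Proof.
move=> x0; apply: normed_cvg.
apply: (@series_le_cvg _ _
    (fun j => (x / 2) ^+ n / n`!%:R * exp_coeff ((x / 2) ^+ 2) j)) => [j|j|j|].
- by rewrite normr_ge0.
- by rewrite mulr_ge0 ?divr_ge0 ?exprn_ge0 ?divr_ge0 ?exp_coeff_ge0 ?sqr_ge0.
- exact: bessel_term_le.
- exact: (@is_cvg_seriesZ R (exp_coeff ((x / 2) ^+ 2)) ((x / 2) ^+ n / n`!%:R)
    (is_cvg_series_exp_coeff _)).
Qed.

(* Evaluates to 2 cos(n th) at any point where [s *: 'X] evaluates to 2 cos th. *)
Fixpoint double_chebyshev (s : C) n : {poly C} :=
  if n is n1.+1 then
    if n1 is n2.+1 then s *: 'X * double_chebyshev s n1 - double_chebyshev s n2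
    else s *: 'X
  else 2%:P.

Lemma double_chebyshevSS s n : double_chebyshev s n.+2 =
  s *: 'X * double_chebyshev s n.+1 - double_chebyshev s n.
Proof. by []. Qed.

Lemma size_double_chebyshev s n : (size (double_chebyshev s n) <= n.+1)%N.
Proof.
suff : (size (double_chebyshev s n) <= n.+1)%N &&
  (size (double_chebyshev s n.+1) <= n.+2)%N by case/andP.
elim: n => [|n /andP[ih1 ih2]].
  by rewrite size_polyC_leq1 (leq_trans (size_scale_leq _ _))// size_polyX.
rewrite ih2 double_chebyshevSS; apply: leq_trans (size_polyD _ _) _.
rewrite geq_max size_polyN; apply/andP; split; last exact: leq_trans ih1 (leqW (leqnSn _)).
rewrite -scalerAl; apply: leq_trans (size_scale_leq _ _) _.
by apply: leq_trans (size_polyMleq _ _) _; rewrite size_polyX.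
Qed.

Lemma horner_double_chebyshev s t (e e' : C) n : e * e' = 1 -> s * t = e + e' ->
  (double_chebyshev s n).[t] = e ^+ n + e' ^+ n.
Proof.
move=> ee st.
suff : (double_chebyshev s n).[t] = e ^+ n + e' ^+ n /\
  (double_chebyshev s n.+1).[t] = e ^+ n.+1 + e' ^+ n.+1 by case.
elim: n => [|n [ih1 ih2]]; first by rewrite !hornerE st -mulr2n.
split => //; rewrite double_chebyshevSS hornerD hornerN hornerM ih1 ih2.
rewrite hornerZ hornerX st !exprS.
have -> : (e + e') * (e * e ^+ n + e' * e' ^+ n) =
  e * (e * e ^+ n) + e' * (e' * e' ^+ n) + (e * e') * (e ^+ n + e' ^+ n) by ring.
by rewrite ee; ring.
Qed.

(** In the Jacobi-Anger expansion the orders n and - n are merged for n >= 1, while order 0 occurs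
    once: hence 1 where [double_chebyshev] has 2. *)
Definition jacobi_coef s n : {poly C} := if n == 0%N then 1 else double_chebyshev s n.

(* With - i x cos th = w e + w e' and e e' = 1, expanding the powers binomially
   and grouping the terms w^(2j+n) / (j! (j+n)!) by [n] produces truncated
   Bessel series. *)
Lemma expi_taylor_jacobi M (x th : R) (s : C) : s * (x * cos th)%:C = (2 * cos th)%:C ->
  expi_taylor M (x * cos th) = \sum_(n < M)
    (- 'i) ^+ n * (series (bessel_term n x) (uphalf (M - n)))%:C *
    (jacobi_coef s n).[(x * cos th)%:C].
Proof.
move=> sx.
pose e := cis th; pose e' := cis (- th); pose w := - 'i * (x / 2)%:C.
have ee : e * e' = 1.
  apply/eqP; rewrite eq_complex /= cosN sinN; apply/andP; split; apply/eqP.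
    by rewrite -(cos2Dsin2 th); ring.
  by ring.
have eDe : (2 * cos th)%:C = e + e'.
  by apply/eqP; rewrite eq_complex /= cosN sinN; apply/andP; split; apply/eqP; ring.
pose F a b := (w * e) ^+ a / a`!%:R * ((w * e') ^+ b / b`!%:R).
have fact0 k : k`!%:R != 0 :> C by rewrite pnatr_eq0 -lt0n fact_gt0.
(* Since e e' = 1, a product e^(j+n) e'^j reduces to e^n; the square of - i inside w^(2j) supplies
   the sign (-1)^j of the Bessel series. *)
have key n j : symmetrized F n j =
    (- 'i) ^+ n * (bessel_term n x j)%:C * (jacobi_coef s n).[(x * cos th)%:C].
  have wE : w ^+ (2 * j + n) = (- 'i) ^+ n * ((-1) ^+ j * (x / 2) ^+ (2 * j + n))%:C.
    rewrite rmorphM !rmorphXn rmorphN1 /w exprMn mulrA; congr (_ * _).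
    by rewrite exprD exprM sqrrN sqr_i mulrC.
  have -> : (bessel_term n x j)%:C = ((-1) ^+ j * (x / 2) ^+ (2 * j + n))%:C
      / (j`!%:R * (j + n)`!%:R).
    rewrite /bessel_term natrC (natrC _ (j + n)`!) -!(rmorphM (real_complex R))
      -(fmorphV (real_complex R)).
    rewrite -(rmorphM (real_complex R)).
    by congr (_%:C); ring.
  rewrite mulrA -wE /symmetrized /jacobi_coef.
  case: eqVneq => [->|n0].
    rewrite addn0 hornerC mulr1 /F mulrACA -exprMn -invfM mulrACA ee mulr1 addn0.
    by rewrite -expr2 -exprM.
  rewrite (horner_double_chebyshev n ee) ?sx// /F mulrDr.
  have ej : e ^+ j * e' ^+ j = 1 by rewrite -exprMn ee expr1n.
  have w2 : w ^+ (2 * j + n) = w ^+ j * w ^+ j * w ^+ n.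
    by rewrite exprD mulnC exprM expr2.
  have wjn u : (w * u) ^+ (j + n) = w ^+ j * w ^+ n * (u ^+ j * u ^+ n).
    by rewrite exprMn exprD (exprD u).
  have wj u : (w * u) ^+ j = w ^+ j * u ^+ j by rewrite exprMn.
  rewrite w2 !wjn !wj.
  have E1 : w ^+ j * w ^+ n * (e ^+ j * e ^+ n) / (j + n)`!%:R * (w ^+ j * e' ^+ j / j`!%:R) =
    (w ^+ j * w ^+ j * w ^+ n / (j`!%:R * (j + n)`!%:R) * e ^+ n) * (e ^+ j * e' ^+ j).
    by rewrite invfM; ring.
  have E2 : w ^+ j * e ^+ j / j`!%:R * (w ^+ j * w ^+ n * (e' ^+ j * e' ^+ n) / (j + n)`!%:R) =
    (w ^+ j * w ^+ j * w ^+ n / (j`!%:R * (j + n)`!%:R) * e' ^+ n) * (e ^+ j * e' ^+ j).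
    by rewrite invfM; ring.
  by rewrite [X in X + _]E1 [X in _ + X]E2 ej !mulr1.
transitivity (\sum_(m < M) \sum_(j < m.+1) F (m - j)%N j).
  apply: eq_bigr => m _.
  have -> : - 'i * (x * cos th)%:C = w * e + w * e'.
    rewrite -mulrDr -eDe /w -[RHS]mulrA -rmorphM; congr (_ * _%:C).
    by field.
  rewrite exprDn mulr_suml; apply: eq_bigr => j _.
  have jm : (j <= m)%N by rewrite -ltnS.
  rewrite /F -(bin_fact jm) !natrM -mulr_natr.
  by field; rewrite !fact0 pnatr_eq0 -lt0n bin_gt0 jm.
rewrite sum_antidiagonals sum_triangle_fold sum_triangle_exchange.
apply: eq_bigr => n _; rewrite /series /= big_mkord rmorph_sum mulr_sumr mulr_suml.
by apply: eq_bigr => j _; rewrite key.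
Qed.

End JacobiAnger.

Section JacobiAngerRemainder.
Variable R : realType.
Notation C := R[i].

Lemma nrm_jacobi_coef (s : C) n x th : s * (x * cos th)%:C = (2 * cos th)%:C ->
  nrm (jacobi_coef s n).[(x * cos th)%:C] <= (2 : R).
Proof.
move=> sx; rewrite /jacobi_coef; case: eqVneq => _.
  by rewrite hornerC Normc.normc1 ler1n.
have ee : cis th * cis (- th) = 1.
  apply/eqP; rewrite eq_complex /= cosN sinN; apply/andP; split; apply/eqP.
    by rewrite -(cos2Dsin2 th); ring.
  by ring.
rewrite (@horner_double_chebyshev _ _ _ _ _ n ee); last first.
  rewrite sx; apply/eqP.
  by rewrite eq_complex /= cosN sinN; apply/andP; split; apply/eqP; ring.
by rewrite (le_trans (nrmD _ _))// !nrmX !nrm_cis !expr1n.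
Qed.

(** The orders below [N] of exp(-i x cos th), as a polynomial in t = x cos th. The parameter [s]
    stands for 2 / x, so that s t = 2 cos th. *)
Definition jacobi_poly N (s : C) (x : R) : {poly C} :=
  \sum_(n < N) ((- 'i) ^+ n * (besselJ n x)%:C) *: jacobi_coef s n.

Lemma size_jacobi_poly N s x : (size (jacobi_poly N s x) <= N)%N.
Proof.
apply: (leq_trans (size_sum _ _ _)); apply/bigmax_leqP => n _.
apply: (leq_trans (size_scale_leq _ _)); apply: leq_trans (ltn_ord n).
rewrite /jacobi_coef; case: eqVneq => [->|_]; first by rewrite size_poly1.
exact: size_double_chebyshev.
Qed.

Lemma nrmNi_exp n : nrm ((- 'i : C) ^+ n) = 1.
Proof.
rewrite nrmX (_ : nrm (- 'i) = 1) ?expr1n//.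
by rewrite /= oppr0 expr0n add0r sqrrN expr1n sqrtr1.
Qed.

(* The four errors are the Taylor remainder of order [M], the truncation of the
   Bessel series below [L], the Bessel tail from [N] to [L], and the orders
   from [L] to [M], bounded crudely.  They are controlled by letting first [M]
   and then [L] tend to infinity. *)
Lemma jacobi_remainder_truncated N L M x th (s : C) : 0 <= x ->
  s * (x * cos th)%:C = (2 * cos th)%:C -> (N <= L <= M)%N ->
  nrm (cis (- (x * cos th)) - (jacobi_poly N s x).[(x * cos th)%:C]) <=
  (x ^+ M / M`!%:R
   + \sum_(n < L) 2 * `|series (bessel_term n x) (uphalf (M - n)) - besselJ n x|)
  + \sum_(N <= n < L) 2 * `|besselJ n x|
  + 2 * expR ((x / 2) ^+ 2) * \sum_(L <= n < M) (x / 2) ^+ n / n`!%:R.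
Proof.
move=> x0 sx /andP[NL LM].
set t := x * cos th.
pose g n := (- 'i) ^+ n * (jacobi_coef s n).[t%:C].
pose S n := series (bessel_term n x) (uphalf (M - n)).
have g2 n (a : R) : nrm (g n * a%:C) <= 2 * `|a|.
  rewrite nrmM nrm_real ler_wpM2r// nrmM nrmNi_exp mul1r.
  exact: nrm_jacobi_coef.
have pE : (jacobi_poly N s x).[t%:C] = \sum_(0 <= n < N) g n * (besselJ n x)%:C.
  rewrite /jacobi_poly horner_sum big_mkord; apply: eq_bigr => n _.
  by rewrite hornerZ /g; ring.
have TE : expi_taylor M t = \sum_(0 <= n < M) g n * (S n)%:C.
  rewrite (expi_taylor_jacobi _ sx) big_mkord; apply: eq_bigr => n _.
  by rewrite /g /S; ring.
have -> : cis (- t) - (jacobi_poly N s x).[t%:C] =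
    (cis (- t) - expi_taylor M t)
    + (\sum_(0 <= n < L) g n * (S n - besselJ n x)%:C)
    + \sum_(N <= n < L) g n * (besselJ n x)%:C
    + \sum_(L <= n < M) g n * (S n)%:C.
  have -> : expi_taylor M t = \sum_(0 <= n < L) g n * (S n)%:C +
      \sum_(L <= n < M) g n * (S n)%:C.
    by rewrite TE; exact: big_cat_nat.
  rewrite pE.
  under [X in _ = _ + X + _ + _]eq_bigr do rewrite rmorphB mulrBr.
  rewrite sumrB /=.
  have -> : \sum_(0 <= n < L) g n * (besselJ n x)%:C =
      \sum_(0 <= n < N) g n * (besselJ n x)%:C + \sum_(N <= n < L) g n * (besselJ n x)%:C.
    exact: big_cat_nat.
  by ring.
apply: (le_trans (nrmD _ _)); apply: lerD; last first.
  apply: (le_trans (nrm_sum _ _ _)); rewrite mulr_sumr; apply: ler_sum => n _.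
  apply: (le_trans (g2 _ _)); rewrite -mulrA ler_pM2l// mulrC.
  exact: bessel_partial_le.
apply: (le_trans (nrmD _ _)); apply: lerD; last first.
  by apply: (le_trans (nrm_sum _ _ _)); apply: ler_sum => n _.
apply: (le_trans (nrmD _ _)); apply: lerD; last first.
  apply: (le_trans (nrm_sum _ _ _)); rewrite big_mkord; apply: ler_sum => n _.
  exact: g2.
apply: (le_trans (expi_taylor_le _ _)).
rewrite ler_wpM2r// lerXn2r ?nnegrE// normrM (ger0_norm x0) ler_piMr//.
by rewrite ler_norml cos_geN1 cos_le1.
Qed.

Lemma jacobi_remainder N x th (s : C) : 0 <= x ->
  s * (x * cos th)%:C = (2 * cos th)%:C ->
  ((nrm (cis (- (x * cos th)) - (jacobi_poly N s x).[(x * cos th)%:C]))%:E <=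
   2%:E * \sum_(N <= k <oo) `|besselJ k x|%:E)%E.
Proof.
move=> x0 sx; set r := nrm _.
(* Bounds the orders from [L] to [M] for every [M], through the remainder of the series of exp(x /
   2); the limit in [M] leaves it unchanged. *)
pose tail L := 2 * expR ((x / 2) ^+ 2) * (expR (x / 2) - series (exp_coeff (x / 2)) L).
have x20 : 0 <= x / 2 by rewrite divr_ge0.
have exp_nd : nondecreasing_seq (series (exp_coeff (x / 2))).
  by apply/nondecreasing_series => i _ _; rewrite exp_coeff_ge0.
have step L : (N <= L)%N -> r <= \sum_(N <= n < L) 2 * `|besselJ n x| + tail L.
  move=> NL; pose a M := x ^+ M / M`!%:R
    + \sum_(n < L) 2 * `|series (bessel_term n x) (uphalf (M - n)) - besselJ n x|.
  have a0 : a M @[M --> \oo] --> (0 : R).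
    rewrite -[X in _ --> X](addr0 (0 : R)); apply: cvgD; first exact: cvg_exp_coeff.
    rewrite [X in _ --> X](_ : 0 = \sum_(n < L) (0 : R)); last by rewrite big1.
    apply: cvg_big => [|n _]; first exact: add_continuous.
    rewrite -(mulr0 2) -(normr0 R) -(subrr (besselJ n x)).
    apply: cvgMl_tmp; apply: cvg_norm; apply: cvgB; last exact: cvg_cst.
    apply: (@cvg_comp _ _ _ (fun M => uphalf (M - n)) (series (bessel_term n x))
      _ \oo); last exact: is_cvg_bessel.
    apply/cvgnyPge => A; near=> M; rewrite geq_uphalf_double leqW//.
    rewrite leq_subRL; first by near: M; exact: nbhs_infty_ge.
    by near: M; exact: nbhs_infty_ge.
  suff : r - \sum_(N <= n < L) 2 * `|besselJ n x| - tail L <= 0 by lra.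
  apply: (ler_cvg_to (cvg_cst _) a0); near=> M.
  have LM : (L <= M)%N by near: M; exact: nbhs_infty_ge.
  have := @jacobi_remainder_truncated N L M x th s x0 sx; rewrite NL LM => /(_ isT).
  rewrite -/r -/(a M).
  have : \sum_(L <= n < M) (x / 2) ^+ n / n`!%:R <=
      expR (x / 2) - series (exp_coeff (x / 2)) L.
    have -> : \sum_(L <= n < M) (x / 2) ^+ n / n`!%:R =
        series (exp_coeff (x / 2)) M - series (exp_coeff (x / 2)) L.
      by rewrite sub_series_geq.
    rewrite lerD2r; apply: nondecreasing_cvgn_le => //.
    exact: is_cvg_series_exp_coeff.
  rewrite -(@ler_pM2l _ (2 * expR ((x / 2) ^+ 2))) ?mulr_gt0 ?expR_gt0//.
  rewrite -/(tail L); lra.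
have tail0 : tail L @[L --> \oo] --> (0 : R).
  rewrite -(mulr0 (2 * expR ((x / 2) ^+ 2))) -(subrr (expR (x / 2))).
  apply: cvgMl_tmp; apply: cvgB; first exact: cvg_cst.
  exact: is_cvg_series_exp_coeff.
(* The sum of the Bessel values is an extended real; when it is infinite the bound is trivial, so
   its convergence can be taken for granted from here on. *)
have [->|Sfin] := eqVneq (\sum_(N <= k <oo) `|besselJ k x|%:E)%E +oo%E.
  by rewrite gt0_muley ?lte_fin// leey.
set S := (X in (_ * X)%E) in Sfin *.
have S0 : (0 <= S)%E by apply: nneseries_ge0 => n _ _; rewrite lee_fin.
have SE : S = (fine S)%:E by rewrite fineK// ge0_fin_numE// ltey.
rewrite SE -EFinM lee_fin -subr_le0.
apply: (ler_cvg_to (cvg_cst _) tail0); near=> L.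
have NL : (N <= L)%N by near: L; exact: nbhs_infty_ge.
have : \sum_(N <= n < L) 2 * `|besselJ n x| <= 2 * fine S.
  rewrite -mulr_sumr ler_pM2l// -lee_fin -SE -sumEFin.
  by apply: nneseries_lim_ge => n _ _; rewrite lee_fin.
have := step L NL; lra.
Unshelve. all: by end_near.
Qed.

End JacobiAngerRemainder.

(** * Polynomial approximation of exp(-i t) on [-zeta, zeta] *)

Section PolynomialApproximation.
Variable R : realType.
Notation C := R[i].

Definition taylor_poly N : {poly C} := \poly_(k < N) ((- 'i) ^+ k / k`!%:R).

Lemma horner_taylor_poly N (t : R) : (taylor_poly N).[t%:C] = expi_taylor N t.
Proof.
rewrite horner_poly; apply: eq_bigr => k _.
by rewrite exprMn mulrAC.
Qed.

(* At [x = 0] both [t / x] and [2 / x] are the junk value 0, so that the angle is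
   [acos 0] and the relation [(2 / x) t = 2 cos th] still holds. *)
Lemma jacobi_poly_le N (x t : R) : `|t| <= x ->
  ((nrm (cis (- t) - (jacobi_poly N (2 / x)%:C x).[t%:C]))%:E <=
   2%:E * \sum_(N <= k <oo) `|besselJ k x|%:E)%E.
Proof.
move=> tx; have x0 : 0 <= x := le_trans (normr_ge0 t) tx.
have tE : t = x * (t / x).
  have [xE|x0'] := eqVneq x 0; last by field.
  by move: tx; rewrite xE normr_le0 => /eqP ->; rewrite mul0r.
have t1 : -1 <= t / x <= 1.
  have [->|xn0] := eqVneq x 0; first by rewrite invr0 mulr0 ler01 andbT oppr_le0.
  by rewrite -ler_norml normrM normfV (ger0_norm x0) ler_pdivrMr ?mul1r// lt_def xn0.
have cE : cos (acos (t / x)) = t / x by rewrite acosK// in_itv.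
have := @jacobi_remainder R N x (acos (t / x)) (2 / x)%:C x0.
rewrite cE -tE; apply; rewrite -rmorphM; congr (_%:C).
by rewrite mulrAC mulrA.
Qed.

Lemma chi_ge0 N (zeta : R) : 0 <= zeta -> 0 <= chi N zeta.
Proof.
move=> z0; rewrite /chi; case: eqVneq => // _; apply: fine_ge0.
rewrite !le_min !lee_fin ler01 divr_ge0 ?exprn_ge0//= mule_ge0//.
by apply: nneseries_ge0 => n _ _; rewrite lee_fin.
Qed.

Lemma chi_le N (zeta : R) : 0 <= zeta -> chi N zeta <= zeta ^+ N / N`!%:R.
Proof.
move=> z0; rewrite /chi; case: eqVneq => [->|_]; first by rewrite expr0 fact0 divr1.
set y := (2%:E * _)%E.
have y0 : (0 <= y)%E.
  rewrite mule_ge0//; by apply: nneseries_ge0 => n _ _; rewrite lee_fin.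
rewrite -lee_fin fineK; last first.
  rewrite ge0_fin_numE ?gt_min ?ltry//.
  by rewrite !le_min !lee_fin ler01 divr_ge0 ?exprn_ge0.
by rewrite !ge_min lexx orbT.
Qed.

(** Each term of the minimum in [chi] has its own polynomial: 0 for the value 1, the Taylor
    polynomial for zeta^N / N!, the truncated Jacobi-Anger expansion for the Bessel tail. *)
Lemma chi_approx N (zeta : R) : 0 <= zeta ->
  exists2 p : {poly C}, (size p <= N)%N &
    forall t, `|t| <= zeta -> nrm (cis (- t) - p.[t%:C]) <= chi N zeta.
Proof.
move=> z0; rewrite /chi; case: eqVneq => [->|_].
  by exists 0 => [|t _]; rewrite ?size_poly0// horner0 subr0 nrm_cis.
set y := (2%:E * _)%E; set u := Order.min _ _.
have [->|] : u = 1%:E \/ (u = (zeta ^+ N / N`!%:R)%:E \/ u = y).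
  rewrite /u; case: leP => _; first by left.
  by case: leP => _; right; [left|right].
  by exists 0 => [|t _]; rewrite ?size_poly0// horner0 subr0 nrm_cis.
case=> uE.
  exists (taylor_poly N) => [|t tz]; first exact: size_poly.
  rewrite horner_taylor_poly uE (le_trans (expi_taylor_le _ _))//=.
  by rewrite ler_wpM2r// lerXn2r// nnegrE.
exists (jacobi_poly N (2 / zeta)%:C zeta) => [|t tz]; first exact: size_jacobi_poly.
have u0 : (0 <= u)%E.
  rewrite !le_min !lee_fin ler01 divr_ge0 ?exprn_ge0//= mule_ge0//.
  by apply: nneseries_ge0 => n _ _; rewrite lee_fin.
(* [fine] loses nothing: the minimum [u] is at most 1, and the Bessel tail equals it here. *)
rewrite -lee_fin fineK ?uE; first exact: jacobi_poly_le.
by rewrite -uE ge0_fin_numE// gt_min ltry.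
Qed.

End PolynomialApproximation.

(** * Dilations and essential centres *)

Section Dilation.
Variable R : realType.
Implicit Types (c : R) (X : set R).

Lemma mem_dilate c X (x : R) : c != 0 -> dilate c X x <-> X (c^-1 * x).
Proof.
move=> c0; split=> [[b Xb <-]|Xx]; first by rewrite mulKf.
by exists (c^-1 * x) => //; rewrite mulVKf.
Qed.

Lemma dilateK c X : c != 0 -> dilate c^-1 (dilate c X) = X.
Proof.
move=> c0; apply/seteqP; split=> x; rewrite !mem_dilate ?invr_eq0// invrK mulKf//.
Qed.

Lemma dilate_itv_oc c (a b : R) : 0 < c ->
  dilate c `]a, b]%classic = `](c * a), (c * b)]%classic.
Proof.
move=> c0; apply/seteqP; split=> x.
  by case=> y; rewrite /= !in_itv/= => /andP[ay yb] <-; rewrite ltr_pM2l// ler_pM2l// ay.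
rewrite /= in_itv/= => /andP[ax xb]; exists (c^-1 * x).
  by rewrite /= in_itv/= ltr_pdivlMl// ax ler_pdivrMl.
by rewrite mulVKf// gt_eqF.
Qed.

Local Open Scope ereal_scope.

(** [leb] is an infimum over covers by half-open intervals, and dilating a cover multiplies its
    lengths by c. This is valid for arbitrary sets; dilating back by c^-1 then gives equality. *)
Let leb_dilate_le c X : (0 < c)%R -> leb (dilate c X) <= c%:E * leb X.
Proof.
move=> c0; rewrite -lee_pdivrMl//; apply: le_ereal_inf_tmp => _ [F [mF XF] <-].
rewrite lee_pdivrMl// -nneseriesZl//.
apply: ereal_inf_lbound; exists (fun n => dilate c (F n)).
  split=> [n|x [y Xy <-]].
    by have [[a b] _ <-] := mF n; rewrite dilate_itv_oc//; exact: is_ocitv.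
  by have [n _ Fy] := XF y Xy; exists n => //; exists y.
apply: eq_eseriesr => n _; have [[a b] _ <-] := mF n; rewrite dilate_itv_oc//=.
rewrite !wlength_itv/= !lte_fin ltr_pM2l//; case: ifPn => _; last by rewrite mule0.
by rewrite -!EFinB -EFinM mulrBr.
Qed.

Lemma leb_dilate c X : (0 < c)%R -> leb (dilate c X) = c%:E * leb X.
Proof.
move=> c0; apply/eqP; rewrite eq_le leb_dilate_le//=.
rewrite -lee_pdivlMl//; have := @leb_dilate_le c^-1 (dilate c X).
by rewrite dilateK ?gt_eqF// invr_gt0; exact.
Qed.

Lemma dilateI c X Y : c != 0%R -> dilate c X `&` dilate c Y = dilate c (X `&` Y).
Proof.
by move=> c0; apply/seteqP; split=> x; rewrite /setI /= !mem_dilate.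
Qed.

Lemma dilateC c X : c != 0%R -> ~` dilate c X = dilate c (~` X).
Proof.
by move=> c0; apply/seteqP; split=> x; rewrite /setC /= !mem_dilate.
Qed.

(** True by definition, the measurable sets being those of Caratheodory. Since the scaling of [leb]
    is known for arbitrary sets, the criterion passes to dilated sets. *)
Lemma lebesgue_measurableP X : lebesgue_measurable X =
  (forall Y : set R, leb Y = leb (Y `&` X) + leb (Y `&` ~` X)).
Proof. by []. Qed.

Lemma measurable_dilate c X : (0 < c)%R ->
  lebesgue_measurable X -> lebesgue_measurable (dilate c X).
Proof.
rewrite !lebesgue_measurableP => c0 mX Y; have cn0 : c != 0%R by rewrite gt_eqF.
have YE : Y = dilate c (dilate c^-1 Y).
  by rewrite -{1}[c]invrK dilateK// invr_eq0.
move: (dilate c^-1 Y) YE => Z ->; rewrite dilateC// !dilateI// !leb_dilate// -ge0_muleDr//.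
by rewrite mX.
Qed.

Lemma measurable_fun_scale c : (0 < c)%R ->
  measurable_fun setT (fun x : lebesgue_type R => (c * x)%R : lebesgue_type R).
Proof.
move=> c0 _ Y mY; rewrite setTI.
rewrite (_ : _ @^-1` _ = dilate c^-1 Y).
  by apply: measurable_dilate; rewrite ?invr_gt0.
by apply/seteqP; split=> x; rewrite mem_dilate ?invr_eq0 ?gt_eqF// invrK.
Qed.

(** The pushforward of [leb] under x |-> c x is c^-1 times [leb]: these are [m1] and [m2], which
    agree on measurable sets. *)
Lemma lint_dilate c X (f : R -> \bar R) : (0 < c)%R -> lebesgue_measurable X ->
  measurable_fun setT (f : lebesgue_type R -> \bar R) -> (forall x, 0 <= f x) ->
  lint (dilate c X) f = c%:E * lint X (fun x => f (c * x)%R).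
Proof.
move=> c0 mX mf f0; have mcX := measurable_dilate c0 mX.
have cV0 : (0 <= c^-1)%R by rewrite invr_ge0 ltW.
have preX : (fun x : R => c * x)%R @^-1` (dilate c X) = X.
  by apply/seteqP; split=> x /=; rewrite mem_dilate ?gt_eqF// mulKf ?gt_eqF.
have pull := @ge0_integral_pushforward _ _ (lebesgue_type R) (lebesgue_type R) R
  _ (measurable_fun_scale c0) leb (dilate c X) f mcX (measurable_funTS mf)
  (fun x _ => f0 x).
pose m0 := (pushforward leb (fun x : lebesgue_type R => (c * x)%R : lebesgue_type R)
   : {measure set (lebesgue_type R) -> \bar R}).
pose m1 := m0 (measurable_fun_scale c0).
pose m2 : {measure set (lebesgue_type R) -> \bar R} := mscale (NngNum cV0) leb.
have scale : lint X (fun x => f (c * x)%R) = \int[m2]_(y in dilate c X) f y.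
  transitivity (lint ((fun x : R => c * x)%R @^-1` (dilate c X)) (fun x => f (c * x)%R)).
    by rewrite preX.
  transitivity (\int[m1]_(y in dilate c X) f y); first exact: (esym pull).
  refine (@eq_measure_integral _ _ _ _ m2 m1 f _) => Y mY _.
  transitivity (leb (dilate c^-1 Y)); last by rewrite leb_dilate ?invr_gt0.
  rewrite /m1 /pushforward /=; congr (leb _).
  by apply/seteqP; split=> x; rewrite mem_dilate ?invr_eq0 ?gt_eqF// invrK.
rewrite scale ge0_integral_mscale//; last exact: measurable_funTS.
by rewrite muleA -EFinM mulfV ?mul1e// gt_eqF.
Qed.

End Dilation.

(** * Essential bounds, essential diameter and essential centres *)

Section LebesgueSets.
Variable R : realType.
Implicit Types (D : set R) (h : R -> R).

Lemma lebesgue_measurable_id :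
  measurable_fun setT (fun x : lebesgue_type R => x : R).
Proof. by move=> _ Y mY; rewrite setTI; exact: sub_caratheodory. Qed.

Lemma borel_lebesgue_measurable_fun (f : R -> R) :
  measurable_fun setT f -> lebesgue_measurable_fun f.
Proof. by move=> mf; exact: (measurableT_comp mf lebesgue_measurable_id). Qed.

Lemma bounded_setP D : bounded_set D -> exists2 M : R, 0 < M & forall x, D x -> `|x| <= M.
Proof. by move=> /pinfty_ex_gt0[M M0 DM]; exists M. Qed.

Lemma ae_in_null D (P : R -> Prop) : lebesgue_measurable D -> leb D = 0%E ->
  \forall x \ae leb, D x -> P x.
Proof.
by move=> mD D0; exists D; split => // x /= /not_implyP[].
Qed.

(** One encoding for both essential bounds: h = id yields [esssup_of], and the opposite map yields
    minus [essinf_of]. *)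
Definition off_set D h (x : R) : \bar R := if x \in D then (h x)%:E else -oo%E.

Lemma ess_sup_off_set_fin D h : lebesgue_measurable D ->
  (exists M : R, forall x, D x -> `|h x| <= M) -> leb D != 0%E ->
  ess_sup leb (off_set D h) \is a fin_num.
Proof.
move=> mD [M DM] D0; rewrite fin_numE; apply/andP; split.
  apply/eqP => eS; move/eqP: D0; apply.
  have /ess_supP : (ess_sup leb (off_set D h) <= -oo)%E by rewrite eS.
  move=> [N [mN N0 sub]]; apply/eqP; rewrite -measure_le0 -N0.
  apply: le_measure; rewrite ?inE// => x Dx; apply: sub => /=.
  by rewrite /off_set mem_set// leNgt ltNyr.
rewrite -ltey; apply: (@le_lt_trans _ _ M%:E); last exact: ltry.
apply/ess_supP; apply: nearW => x; rewrite /off_set.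
case: ifPn => [/set_mem Dx|_]; last exact: leNye.
by rewrite lee_fin (le_trans (ler_norm _))// DM.
Qed.

Lemma le_ess_sup_off_set D h : lebesgue_measurable D ->
  (exists M : R, forall x, D x -> `|h x| <= M) -> leb D != 0%E ->
  \forall x \ae leb, D x -> h x <= fine (ess_sup leb (off_set D h)).
Proof.
move=> mD bD D0; have := ess_sup_ge leb (off_set D h).
apply: filterS => x /= + Dx; rewrite {1}/off_set mem_set// => xS.
by rewrite -lee_fin fineK// ess_sup_off_set_fin.
Qed.

Lemma lt_ess_sup_off_set D h (s : R) : lebesgue_measurable D ->
  lebesgue_measurable_fun h ->
  (exists M : R, forall x, D x -> `|h x| <= M) -> leb D != 0%E ->
  s < fine (ess_sup leb (off_set D h)) ->
  lebesgue_measurable (D `&` [set x | s < h x]) /\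
  leb (D `&` [set x | s < h x]) != 0%E.
Proof.
move=> mD mh bD D0 sS.
have mI : lebesgue_measurable (D `&` [set x | s < h x]).
  apply: measurableI => //; rewrite -preimage_itvoy -[X in measurable X]setTI.
  exact: (mh measurableT _ (measurable_itv `]s, +oo[)).
split=> //; apply/eqP => N0.
suff : fine (ess_sup leb (off_set D h)) <= s by rewrite leNgt sS.
rewrite -lee_fin fineK ?ess_sup_off_set_fin//; apply/ess_supP.
exists (D `&` [set x | s < h x]); split => //.
move=> x /= /negP; rewrite -ltNge /off_set; case: ifPn => [/set_mem Dx|_ //].
by rewrite lte_fin.
Qed.

Lemma essinf_ofE D : essinf_of D = - fine (ess_sup leb (off_set D -%R)).
Proof.
rewrite /essinf_of ess_infEN fineN; congr (- fine (ess_sup _ _)).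
by apply/funext => x /=; rewrite /off_set; case: ifP.
Qed.

Lemma ess_width_le_diam D : lebesgue_measurable D -> bounded_set D -> leb D != 0%E ->
  esssup_of D - essinf_of D <= diam_ess D.
Proof.
move=> mD /bounded_setP[M M0 DM] D0; rewrite essinf_ofE opprK /esssup_of.
rewrite -/(off_set D id); set s := fine _; set i := fine _.
have bN : exists M0 : R, forall x : R, D x -> `|- x| <= M0.
  by exists M => x Dx; rewrite normrN DM.
have bD : exists M0 : R, forall x : R, D x -> `|x| <= M0 by exists M.
have mN : lebesgue_measurable_fun (-%R : R -> R).
  by apply: borel_lebesgue_measurable_fun; exact: oppr_measurable.
pose g (z : R * R) : \bar R :=
  if (z.1 \in D) && (z.2 \in D) then `|z.1 - z.2|%:E else -oo%E.
rewrite /diam_ess -/g; set Delta := ess_sup _ _.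
(* If Delta <= d < s + i, the sets of points of [D] within e of its two essential
   bounds have positive measure, and their product lies in a null set. *)
have key (d : R) : (Delta <= d%:E)%E -> s + i <= d.
  move=> /ess_supP [N [mN' N0 sub]]; rewrite leNgt; apply/negP => dsi.
  pose e := (s + i - d) / 2.
  have e0 : 0 < e by rewrite divr_gt0// subr_gt0.
  have es : s - e < s by rewrite ltrBlDr ltrDl.
  have ei : i - e < i by rewrite ltrBlDr ltrDl.
  have [m1 n1] := lt_ess_sup_off_set mD lebesgue_measurable_id bD D0 es.
  have [m2 n2] := lt_ess_sup_off_set mD mN bN D0 ei.
  move: m1 n1 m2 n2; set A1 := _ `&` _; set A2 := _ `&` _ => m1 n1 m2 n2.
  have : ((leb \x leb)%E (A1 `*` A2) <= 0)%E.
    rewrite -N0; apply: le_measure; rewrite ?inE//; first exact: measurableX.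
    move=> [x y] [[Dx /= sx] [Dy /= iy]]; apply: sub => /=.
    rewrite /g /= !mem_set//= lee_fin; apply/negP; rewrite -ltNge.
    apply: (lt_le_trans _ (ler_norm _)); move: sx iy; rewrite /e; lra.
  rewrite product_measure1E// leNgt; apply/negP; rewrite negbK.
  by rewrite mule_gt0// lt0e ?n1 ?n2 measure_ge0.
have DeltaM : (Delta <= (M + M)%:E)%E.
  apply/ess_supP; apply: nearW => -[x y]; rewrite /g /=.
  case: ifPn => [/andP[/set_mem Dx /set_mem Dy]|_]; last exact: leNye.
  by rewrite lee_fin (le_trans (ler_normB _ _))// lerD// DM.
case: Delta key DeltaM => [d|//|] key _ /=; first exact: key.
(* In the case Delta = -oo, [key] applies to every real number, and this one is absurd. *)
have := key (s + i - 1) (leNye _); lra.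
Qed.

Lemma ess_range_ae D : lebesgue_measurable D -> bounded_set D -> leb D != 0%E ->
  \forall x \ae leb, D x -> essinf_of D <= x <= esssup_of D.
Proof.
move=> mD /bounded_setP[M M0 DM] D0; rewrite essinf_ofE /esssup_of -/(off_set D id).
have bN : exists M0 : R, forall x : R, D x -> `|- x| <= M0.
  by exists M => x Dx; rewrite normrN DM.
have bD : exists M0 : R, forall x : R, D x -> `|x| <= M0 by exists M.
move: (le_ess_sup_off_set mD bD D0) (le_ess_sup_off_set mD bN D0).
by apply: (@filterS2 _ _ (ae_filter_ringOfSetsType leb)) => x xs xi Dx; rewrite lerNl xi//= xs.
Qed.

Lemma diam_ess_ge0 D : lebesgue_measurable D -> bounded_set D -> 0 <= diam_ess D.
Proof.
move=> mD bD; have [D0|D0] := eqVneq (leb D) 0%E; last first.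
  apply: le_trans (ess_width_le_diam mD bD D0); rewrite leNgt; apply/negP => si.
  have [N [mN N0 sub]] := ess_range_ae mD bD D0.
  move/eqP: D0; apply; apply/eqP; rewrite -measure_le0 -N0.
  apply: le_measure; rewrite ?inE// => x Dx; apply: sub => /= /(_ Dx).
  by case/andP => ix /(le_trans ix); rewrite leNgt -subr_lt0 si.
(* For a null [D], the values other than -oo occur only on the null set D x R; [fine] sends the
   essential supremum -oo to 0. *)
rewrite /diam_ess; set g := (X in ess_sup _ X).
have -> : ess_sup (leb \x leb)%E g = -oo%E; last by [].
apply/eqP; rewrite -leeNy_eq; apply/ess_supP.
exists (D `*` setT); split.
- exact: measurableX.
- apply: (etrans (product_measure1E leb leb mD measurableT)).
  by rewrite [X in (X * _)%E](_ : _ = 0%E) ?mul0e.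
- move=> [x y] /=; rewrite /g /=; case: ifPn => [/andP[/set_mem Dx _] _|_]; first by [].
  by rewrite lexx.
Qed.

(** Almost every point of [D] lies between the essential bounds, whose distance is at most the
    essential diameter; the midpoint halves it. *)
Lemma ess_centre_ae D (a : R) : lebesgue_measurable D -> bounded_set D ->
  is_ess_centre D a -> \forall x \ae leb, D x -> `|x - a| <= diam_ess D / 2.
Proof.
move=> mD bD aE; have [D0|D0] := eqVneq (leb D) 0%E; first exact: ae_in_null.
have wd := ess_width_le_diam mD bD D0; rewrite (aE D0).
move: (ess_range_ae mD bD D0).
apply: (@filterS _ _ (ae_filter_ringOfSetsType leb)) => x + Dx => /(_ Dx) /andP[ix xs].
by rewrite ler_norml; apply/andP; split; lra.
Qed.

End LebesgueSets.

(** * The space L^2 *)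

Section ComplexIntegral.
Variable R : realType.
Notation C := R[i].
Implicit Types (f g : R -> C) (a : C).

Definition cmeasurable f : Prop :=
  lebesgue_measurable_fun (fun x => complex.Re (f x)) /\
  lebesgue_measurable_fun (fun x => complex.Im (f x)).

Definition cintegrable f : Prop :=
  lebesgue_integrable (fun x => complex.Re (f x)) /\
  lebesgue_integrable (fun x => complex.Im (f x)).

Lemma complex_ReM a b : complex.Re (a * b : C) =
  complex.Re a * complex.Re b - complex.Im a * complex.Im b.
Proof. by case: a b => a1 a2 [b1 b2]. Qed.

Lemma complex_ImM a b : complex.Im (a * b : C) =
  complex.Re a * complex.Im b + complex.Im a * complex.Re b.
Proof. by case: a b => a1 a2 [b1 b2]. Qed.

Lemma complex_ReD a b : complex.Re (a + b : C) = complex.Re a + complex.Re b.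
Proof. by case: a b => a1 a2 [b1 b2]. Qed.

Lemma complex_ImD a b : complex.Im (a + b : C) = complex.Im a + complex.Im b.
Proof. by case: a b => a1 a2 [b1 b2]. Qed.

Lemma complex_ReJ a : complex.Re (conjc a) = complex.Re a.
Proof. by case: a. Qed.

Lemma complex_ImJ a : complex.Im (conjc a) = - complex.Im a.
Proof. by case: a. Qed.

Lemma complex_ext a b : complex.Re a = complex.Re b -> complex.Im a = complex.Im b -> a = b.
Proof. by case: a b => a1 a2 [b1 b2] /= -> ->. Qed.

Lemma cmeasurableD f g : cmeasurable f -> cmeasurable g ->
  cmeasurable (fun x => f x + g x).
Proof.
move=> [f1 f2] [g1 g2]; split.
  under eq_fun do rewrite complex_ReD; exact: measurable_funD.
under eq_fun do rewrite complex_ImD; exact: measurable_funD.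
Qed.

Lemma cmeasurableM f g : cmeasurable f -> cmeasurable g ->
  cmeasurable (fun x => f x * g x).
Proof.
move=> [f1 f2] [g1 g2]; split.
  under eq_fun do rewrite complex_ReM.
  by apply: measurable_funB; exact: measurable_funM.
under eq_fun do rewrite complex_ImM.
by apply: measurable_funD; exact: measurable_funM.
Qed.

Lemma cmeasurableJ f : cmeasurable f -> cmeasurable (fun x => conjc (f x)).
Proof.
move=> [f1 f2]; split; first by under eq_fun do rewrite complex_ReJ.
by under eq_fun do rewrite complex_ImJ; apply: measurableT_comp.
Qed.

Lemma cmeasurable_cst a : cmeasurable (fun=> a).
Proof. by split; exact: measurable_cst. Qed.

Lemma lebesgue_integrableZ (k : R) (f : R -> R) :
  lebesgue_integrable f -> lebesgue_integrable (fun x => k * f x).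
Proof.
move=> fi; rewrite /comp; under eq_fun do rewrite EFinM.
exact: integrableZl.
Qed.

Lemma lebesgue_integrableD (f g : R -> R) : lebesgue_integrable f ->
  lebesgue_integrable g -> lebesgue_integrable (fun x => f x + g x).
Proof.
move=> fi gi; rewrite /comp; under eq_fun do rewrite EFinD.
exact: integrableD.
Qed.

Lemma cintegrableZ a f : cintegrable f -> cintegrable (fun x => a * f x).
Proof.
move=> [f1 f2]; split; rewrite /comp.
  under eq_fun do rewrite complex_ReM EFinB; apply: integrableB => //;
  exact: lebesgue_integrableZ.
under eq_fun do rewrite complex_ImM EFinD; apply: integrableD => //;
exact: lebesgue_integrableZ.
Qed.

Lemma cintegrable_le f (h : R -> R) : cmeasurable f -> lebesgue_integrable h ->
  (forall x, `|complex.Re (f x)| <= h x) -> (forall x, `|complex.Im (f x)| <= h x) ->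
  cintegrable f.
Proof.
move=> [f1 f2] hi h1 h2; split.
  refine (le_integrable measurableT _ _ hi).
    apply/measurable_EFinP.
    exact: f1.
  move=> x _ /=.
  by rewrite lee_fin (le_trans (h1 x))// ler_norm.
refine (le_integrable measurableT _ _ hi).
  by apply/measurable_EFinP; exact: f2.
by move=> x _ /=; rewrite lee_fin (le_trans (h2 x))// ler_norm.
Qed.

Notation Rint f := (Rintegral leb setT (f : lebesgue_type R -> R)).

Lemma cintE f : cint setT f =
  Rint (fun x => complex.Re (f x)) +i* Rint (fun x => complex.Im (f x)).
Proof. by []. Qed.

Lemma cintD f g : cintegrable f -> cintegrable g ->
  cint setT (fun x => f x + g x) = cint setT f + cint setT g.
Proof.
move=> [f1 f2] [g1 g2]; apply: complex_ext; rewrite ?complex_ReD ?complex_ImD !cintE /=.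
  by under eq_Rintegral do rewrite complex_ReD; rewrite RintegralD.
by under eq_Rintegral do rewrite complex_ImD; rewrite RintegralD.
Qed.

Lemma cintZ a f : cintegrable f -> cint setT (fun x => a * f x) = a * cint setT f.
Proof.
move=> [f1 f2]; apply: complex_ext; rewrite ?complex_ReM ?complex_ImM !cintE /=.
  under eq_Rintegral do rewrite complex_ReM.
  by rewrite RintegralB ?RintegralZl//; exact: lebesgue_integrableZ.
under eq_Rintegral do rewrite complex_ImM.
by rewrite RintegralD ?RintegralZl//; exact: lebesgue_integrableZ.
Qed.

Lemma cintJ f : cintegrable f -> cint setT (fun x => conjc (f x)) = conjc (cint setT f).
Proof.
move=> [f1 f2]; apply: complex_ext; rewrite ?complex_ReJ ?complex_ImJ !cintE /=.
  by under eq_Rintegral do rewrite complex_ReJ.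
by under eq_Rintegral do rewrite complex_ImJ -mulN1r; rewrite RintegralZl// mulN1r.
Qed.

Lemma cint0 : cint setT (fun=> 0) = 0 :> C.
Proof. by rewrite cintE /= !Rintegral_cst// !mul0r. Qed.

Lemma cint_ae f g : cmeasurable f -> cmeasurable g -> ae_equal f g ->
  cint setT f = cint setT g.
Proof.
move=> [f1 f2] [g1 g2] fg; rewrite !cintE /Rintegral; congr (fine _ +i* fine _).
  apply: (ae_eq_integral _ _ measurableT).
  - by apply/measurable_EFinP; exact: f1.
  - by apply/measurable_EFinP; exact: g1.
  - by move: fg; apply: (@filterS _ _ (ae_filter_ringOfSetsType leb)) => x /= ->.
apply: (ae_eq_integral _ _ measurableT).
- by apply/measurable_EFinP; exact: f2.
- by apply/measurable_EFinP; exact: g2.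
- by move: fg; apply: (@filterS _ _ (ae_filter_ringOfSetsType leb)) => x /= ->.
Qed.

End ComplexIntegral.

Section L2Space.
Variable R : realType.
Notation C := R[i].
Implicit Types (f g h : R -> C) (a : C).

Lemma normsq_ge0 (z : C) : 0 <= normsq z.
Proof. by rewrite addr_ge0 ?sqr_ge0. Qed.

Lemma normsq_eq0 (z : C) : normsq z = 0 -> z = 0.
Proof.
move/eqP; rewrite paddr_eq0 ?sqr_ge0// !sqrf_eq0 => /andP[/eqP z1 /eqP z2].
exact: complex_ext.
Qed.

Lemma normsqM (z w : C) : normsq (z * w) = normsq z * normsq w.
Proof. by rewrite /normsq complex_ReM complex_ImM; ring. Qed.

Lemma normsqJ (z : C) : normsq (conjc z) = normsq z.
Proof. by rewrite /normsq complex_ReJ complex_ImJ sqrrN. Qed.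

Lemma normsqD_le (z w : C) : normsq (z + w) <= 2 * (normsq z + normsq w).
Proof.
rewrite /normsq complex_ReD complex_ImD -subr_ge0.
have := sqr_ge0 (complex.Re z - complex.Re w).
have := sqr_ge0 (complex.Im z - complex.Im w).
rewrite !expr2; lra.
Qed.

Lemma mulJ_normsq (z : C) : z * conjc z = (normsq z)%:C.
Proof.
by apply: complex_ext; rewrite ?complex_ReM ?complex_ImM complex_ReJ complex_ImJ /normsq /=; ring.
Qed.

Lemma measurable_normsq f : cmeasurable f ->
  lebesgue_measurable_fun (fun x => normsq (f x)).
Proof.
move=> [f1 f2]; rewrite /normsq; apply: measurable_funD.
  by apply: measurable_funX; exact: f1.
by apply: measurable_funX; exact: f2.
Qed.

Lemma L2P f : L2 f <-> cmeasurable f /\ lebesgue_integrable (fun x => normsq (f x)).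
Proof.
split=> [[f1 f2 fi]|[[f1 f2] fi]].
  split; first by split.
  apply/integrableP; split.
    by apply/measurable_EFinP; apply: measurable_normsq; split.
  move: fi; congr (_ < _)%E; apply: eq_integral => x _.
  by rewrite /= ger0_norm ?normsq_ge0.
split; [exact: f1|exact: f2|].
move/integrableP : fi => [_]; congr (_ < _)%E; apply: eq_integral => x _.
by rewrite /= ger0_norm ?normsq_ge0.
Qed.

Lemma L2_cmeasurable f : L2 f -> cmeasurable f.
Proof. by case/L2P. Qed.

Lemma L2_le f (k : R -> R) : cmeasurable f -> lebesgue_integrable k ->
  (forall x, normsq (f x) <= k x) -> L2 f.
Proof.
move=> mf ki fk; apply/L2P; split; first exact: mf.
refine (le_integrable measurableT _ _ ki).
  by apply/measurable_EFinP; exact: measurable_normsq.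
by move=> x _ /=; rewrite lee_fin ger0_norm ?normsq_ge0// (le_trans (fk x))// ler_norm.
Qed.

Lemma L20 : L2 (fun=> 0 : C).
Proof.
apply: (@L2_le _ (fun=> 0)); first exact: cmeasurable_cst.
  exact: integrable0.
by move=> x; rewrite /normsq /= expr0n addr0.
Qed.

Lemma L2D f g : L2 f -> L2 g -> L2 (fun x => f x + g x).
Proof.
move=> /L2P[mf fi] /L2P[mg gi].
apply: (@L2_le _ (fun x => 2 * (normsq (f x) + normsq (g x)))).
- exact: cmeasurableD.
- by apply: lebesgue_integrableZ; exact: lebesgue_integrableD.
- by move=> x; exact: normsqD_le.
Qed.

Lemma L2Z a f : L2 f -> L2 (fun x => a * f x).
Proof.
move=> /L2P[mf fi].
apply: (@L2_le _ (fun x => normsq a * normsq (f x))).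
- by apply: cmeasurableM; [exact: cmeasurable_cst|exact: mf].
- exact: lebesgue_integrableZ.
- by move=> x; rewrite normsqM.
Qed.

Lemma L2_sum I (s : seq I) (a : I -> C) (f : I -> R -> C) : (forall i, L2 (f i)) ->
  L2 (fun x => \sum_(i <- s) a i * f i x).
Proof.
move=> fL; elim: s => [|i s ih].
  by under eq_fun do rewrite big_nil; exact: L20.
by under eq_fun do rewrite big_cons; apply: L2D => //; exact: L2Z.
Qed.

Lemma L2_mulJ_integrable f g : L2 f -> L2 g ->
  cintegrable (fun x => f x * conjc (g x)).
Proof.
move=> /L2P[mf fi] /L2P[mg gi].
apply: (@cintegrable_le _ _ (fun x => normsq (f x) + normsq (g x))).
- by apply: cmeasurableM; [exact: mf|exact: cmeasurableJ].
- exact: lebesgue_integrableD.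
- move=> x; rewrite complex_ReM complex_ReJ complex_ImJ /normsq ler_norml.
  move: (complex.Re _) (complex.Im _) (complex.Re _) (complex.Im _) => p q r s.
  have := sqr_ge0 (p + r); have := sqr_ge0 (p - r).
  have := sqr_ge0 (q + s); have := sqr_ge0 (q - s).
  have := sqr_ge0 p; have := sqr_ge0 q; have := sqr_ge0 r; have := sqr_ge0 s.
  by rewrite !expr2; lra.
- move=> x; rewrite complex_ImM complex_ReJ complex_ImJ /normsq ler_norml.
  move: (complex.Re _) (complex.Im _) (complex.Im _) (complex.Re _) => p q r s.
  have := sqr_ge0 (p + r); have := sqr_ge0 (p - r).
  have := sqr_ge0 (q + s); have := sqr_ge0 (q - s).
  have := sqr_ge0 p; have := sqr_ge0 q; have := sqr_ge0 r; have := sqr_ge0 s.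
  by rewrite !expr2; lra.
Qed.

Definition L2normsq f : R := fine (lint setT (fun x => (normsq (f x))%:E)).

Lemma L2normsq_ge0 f : 0 <= L2normsq f.
Proof. by apply/fine_ge0/integral_ge0 => x _; rewrite lee_fin normsq_ge0. Qed.

Lemma L2normsqE (f : R -> C) : L2 f ->
  (L2normsq f)%:E = lint setT (fun x => (normsq (f x))%:E).
Proof.
by move=> /L2P[_ fi]; rewrite fineK//; exact: (integrable_fin_num measurableT fi).
Qed.

Lemma L2normsq_eq0 f : L2 f -> L2normsq f = 0 -> ae_equal f (fun=> 0).
Proof.
move=> /L2P[mf fi] f0.
have : (\int[leb]_x `|(normsq (f x))%:E| = 0)%E.
  rewrite -[RHS]/(0%:E)%E -f0 /L2normsq fineK.
    by apply: eq_integral => x _; rewrite /= ger0_norm ?normsq_ge0.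
  exact: (integrable_fin_num measurableT fi).
have mn : measurable_fun setT (fun x : lebesgue_type R => (normsq (f x))%:E).
  by apply/measurable_EFinP; exact: measurable_normsq.
move/(ae_eq_integral_abs leb measurableT mn).
apply: (@filterS _ _ (ae_filter_ringOfSetsType leb)) => x /= /(_ I) [].
exact: normsq_eq0.
Qed.

Lemma innerZDl a f g h : L2 f -> L2 g -> L2 h ->
  inner (fun x => a * f x + g x) h = a * inner f h + inner g h.
Proof.
move=> fL gL hL; rewrite /inner.
under [X in cint setT X = _]eq_fun do rewrite mulrDl -mulrA.
rewrite cintD; last exact: L2_mulJ_integrable.
  by rewrite cintZ//; exact: L2_mulJ_integrable.
by apply: cintegrableZ; exact: L2_mulJ_integrable.
Qed.

Lemma innerC f g : L2 f -> L2 g -> inner g f = conjc (inner f g).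
Proof.
move=> fL gL; rewrite /inner -cintJ; last exact: L2_mulJ_integrable.
by congr (cint _ _); apply/funext => x; rewrite rmorphM /= conjcK mulrC.
Qed.

Lemma inner0l g : inner (fun=> 0) g = 0 :> C.
Proof. by rewrite /inner; under eq_fun do rewrite mul0r; exact: cint0. Qed.

Lemma inner_suml I (s : seq I) (a : I -> C) (f : I -> R -> C) g :
  (forall i, L2 (f i)) -> L2 g ->
  inner (fun x => \sum_(i <- s) a i * f i x) g = \sum_(i <- s) a i * inner (f i) g.
Proof.
move=> fL gL; elim: s => [|i s ih].
  by under eq_fun do rewrite big_nil; rewrite big_nil inner0l.
under eq_fun do rewrite big_cons; rewrite big_cons -ih.
by apply: innerZDl => //; exact: L2_sum.
Qed.

Lemma inner_sumr I (s : seq I) (a : I -> C) (f : I -> R -> C) g :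
  (forall i, L2 (f i)) -> L2 g ->
  inner g (fun x => \sum_(i <- s) a i * f i x) =
  \sum_(i <- s) conjc (a i) * inner g (f i).
Proof.
move=> fL gL; rewrite innerC ?inner_suml//; last exact: L2_sum.
rewrite rmorph_sum; apply: eq_bigr => i _.
by rewrite rmorphM (innerC (fL i) gL).
Qed.

Lemma inner_self f : L2 f -> inner f f = (L2normsq f)%:C.
Proof.
move=> /L2P[mf fi]; rewrite /inner; under eq_fun do rewrite mulJ_normsq.
apply: complex_ext; first by [].
by rewrite cintE /= Rintegral_cst// mul0r.
Qed.

Lemma inner_ael f f' g : L2 f -> L2 f' -> L2 g -> ae_equal f f' ->
  inner f g = inner f' g.
Proof.
move=> fL f'L gL ff'; apply: cint_ae.
- by apply: cmeasurableM; [|apply: cmeasurableJ]; exact: L2_cmeasurable.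
- by apply: cmeasurableM; [|apply: cmeasurableJ]; exact: L2_cmeasurable.
- by move: ff'; apply: (@filterS _ _ (ae_filter_ringOfSetsType leb)) => x /= ->.
Qed.

Lemma L2normsq_ae f g : L2 f -> L2 g -> ae_equal f g -> L2normsq f = L2normsq g.
Proof.
move=> fL gL fg; apply: (@complexI R); rewrite -[LHS]inner_self//.
rewrite (inner_ael fL gL fL fg) (innerC fL gL) (inner_ael fL gL gL fg).
by rewrite inner_self// conjc_real.
Qed.

Lemma innerZDr (a : C) f g h : L2 f -> L2 g -> L2 h ->
  inner h (fun x => a * f x + g x) = conjc a * inner h f + inner h g.
Proof.
move=> fL gL hL; rewrite (innerC (L2D (L2Z a fL) gL) hL) innerZDl//.
rewrite (innerC fL hL) (innerC gL hL).
by move: (inner f h) (inner g h) => z w; rewrite rmorphD rmorphM.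
Qed.

Lemma inner_CauchySchwarz f g : L2 f -> L2 g ->
  normsq (inner f g) <= L2normsq f * L2normsq g.
Proof.
move=> fL gL; have [g0|g0] := eqVneq (L2normsq g) 0.
  rewrite g0 mulr0 (innerC gL fL).
  rewrite (inner_ael gL L20 fL (L2normsq_eq0 gL g0)) inner0l.
  by rewrite rmorph0 /normsq /= expr0n addr0.
have gp : 0 < L2normsq g by rewrite lt_def g0 L2normsq_ge0.
(* Makes [h] the difference of f and its projection onto g, so that |h|^2 = |f|^2 - |<f, g>|^2 /
   |g|^2. *)
pose a := - (inner f g / (L2normsq g)%:C).
pose h x := a * g x + f x.
have hL : L2 h by apply: L2D; [exact: L2Z|exact: fL].
have hg : inner h g = 0.
  rewrite innerZDl// inner_self// /a mulNr divfK ?addNr//.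
  by rewrite eq_complex /= (negPf g0).
have alg (z : C) (r : R) : - (z / r%:C) * conjc z = - (normsq z / r)%:C.
  by rewrite mulNr mulrAC mulJ_normsq -fmorphV -rmorphM.
have : inner h h = (L2normsq f)%:C - (normsq (inner f g) / L2normsq g)%:C.
  rewrite {2}/h innerZDr// hg mulr0 add0r innerZDl// (innerC fL gL) alg.
  by rewrite inner_self// addrC.
rewrite inner_self// -rmorphB => /complexI hE.
by have := L2normsq_ge0 h; rewrite hE subr_ge0 ler_pdivrMr.
Qed.

Lemma bessel_inequality n (e : 'I_n -> R -> C) f : L2 f -> (forall i, L2 (e i)) ->
  (forall i j, inner (e i) (e j) = (i == j)%:R) ->
  \sum_i normsq (inner (e i) f) <= L2normsq f.
Proof.
move=> fL eL on; pose c i := inner f (e i).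
pose s x := \sum_i c i * e i x.
have sL : L2 s by exact: L2_sum.
pose h x := (-1) * s x + f x.
have hL : L2 h by apply: L2D; [exact: L2Z|exact: fL].
have se i : inner s (e i) = c i.
  rewrite inner_suml// (bigD1 i)//= on eqxx mulr1 big1 ?addr0// => j ji.
  by rewrite on (negPf ji) mulr0.
have he i : inner h (e i) = 0 by rewrite innerZDl// se mulN1r addNr.
(* Orthogonality to [s] gives <h, h> = <h, f>, which is |f|^2 minus the sum in question. *)
have hs : inner h s = 0.
  by rewrite inner_sumr// big1// => i _; rewrite he mulr0.
have : inner h h = inner h f by rewrite {2}/h innerZDr// hs mulr0 add0r.
rewrite [RHS]innerZDl// !inner_self// inner_suml// mulN1r addrC.
have -> : \sum_i c i * inner (e i) f = (\sum_i normsq (inner (e i) f))%:C.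
  rewrite rmorph_sum; apply: eq_bigr => i _.
  by rewrite /c (innerC (eL i) fL) mulrC mulJ_normsq.
rewrite -rmorphB => /complexI hE.
by rewrite -subr_ge0 -hE L2normsq_ge0.
Qed.

End L2Space.

(** * The truncated Fourier operator *)

Section FourierOperator.
Variable R : realType.
Notation C := R[i].
Notation L := (lebesgue_type R).
Implicit Types (f g h : R -> C) (A B : set R).

Lemma measurable_cis (theta : R -> R) : lebesgue_measurable_fun theta ->
  cmeasurable (fun x => cis (theta x)).
Proof.
move=> mt; split => /=.
  apply: (measurableT_comp _ mt); apply: continuous_measurable_fun.
  exact: continuous_cos.
apply: (measurableT_comp _ mt); apply: continuous_measurable_fun.
exact: continuous_sin.
Qed.

Lemma indic_lebesgue_integrable A : lebesgue_measurable A -> (leb A < +oo)%E ->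
  lebesgue_integrable (\1_A : R -> R).
Proof.
move=> mA fA; apply/integrableP; split.
  by apply/measurable_EFinP; apply: measurable_indic.
rewrite (eq_integral (fun x : L => (\1_A x : R)%:E)); last first.
  by move=> x _; rewrite /= ger0_norm.
by rewrite integral_indic// setIT.
Qed.

Lemma projE A f x : Defs.proj A f x = (\1_A x : R)%:C * f x.
Proof. by rewrite /Defs.proj indicE; case: ifP => _; rewrite ?mul1r ?mul0r. Qed.

Lemma cmeasurable_proj A f : lebesgue_measurable A -> cmeasurable f ->
  cmeasurable (Defs.proj A f).
Proof.
move=> mA mf; rewrite (_ : Defs.proj A f = fun x => (\1_A x : R)%:C * f x); last first.
  by apply/funext => x; exact: projE.
apply: cmeasurableM => //; split => /=; last exact: measurable_cst.
exact: measurable_indic.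
Qed.

Definition fourier_phase (xi x : R) : R := - (2 * pi * x * xi).

Lemma measurable_fourier_phase (xi : R) : lebesgue_measurable_fun (fourier_phase xi).
Proof.
apply: borel_lebesgue_measurable_fun; apply: measurableT_comp => //.
apply: measurable_funM; last exact: measurable_cst.
exact: mulrl_measurable.
Qed.

(** The integral is by definition the difference of those of the positive and negative parts, each
    measurable in xi by Tonelli. This also covers the xi at which the section is not integrable. *)
Lemma measurable_partial_integral (k : L * L -> R) : measurable_fun setT k ->
  lebesgue_measurable_fun (fun xi => fine (lint setT (fun x => (k (xi, x))%:E))).
Proof.
move=> mk; apply: measurableT_comp; first exact: fine_measurable.
rewrite /lint; under eq_fun do rewrite integralE.
have mE : measurable_fun setT (EFin \o k) by exact/measurable_EFinP.
have mp := @measurable_fun_fubini_tonelli_F _ _ L L R leb (EFin \o k)^\+%E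
  (measurable_funepos mE) (fun=> funepos_ge0 _ _).
have mn := @measurable_fun_fubini_tonelli_F _ _ L L R leb (EFin \o k)^\-%E
  (measurable_funeneg mE) (fun=> funeneg_ge0 _ _).
move: (emeasurable_funB mp mn); congr (measurable_fun _ _); apply/funext => xi.
by congr (_ - _)%E; apply: eq_integral => x _; rewrite ?funeposE ?funenegE.
Qed.

Lemma measurable_fourier g : cmeasurable g -> cmeasurable (fourier g).
Proof.
move=> [g1 g2].
have mph : measurable_fun setT (fun z : L * L => fourier_phase z.1 z.2).
  apply: measurableT_comp => //; apply: measurable_funM.
    apply: measurable_funM; first exact: measurable_cst.
    exact: (measurableT_comp (@lebesgue_measurable_id R) measurable_snd).
  exact: (measurableT_comp (@lebesgue_measurable_id R) measurable_fst).
have mc : measurable_fun setT (fun z : L * L => cos (fourier_phase z.1 z.2)).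
  apply: (measurableT_comp _ mph); apply: continuous_measurable_fun.
  exact: continuous_cos.
have ms : measurable_fun setT (fun z : L * L => sin (fourier_phase z.1 z.2)).
  apply: (measurableT_comp _ mph); apply: continuous_measurable_fun.
  exact: continuous_sin.
have mg1 : measurable_fun setT (fun z : L * L => complex.Re (g z.2)).
  exact: (measurableT_comp g1 measurable_snd).
have mg2 : measurable_fun setT (fun z : L * L => complex.Im (g z.2)).
  exact: (measurableT_comp g2 measurable_snd).
split.
  apply: (@measurable_partial_integral (fun z => complex.Re (cis (fourier_phase z.1 z.2) * g z.2))).
  under eq_fun do rewrite complex_ReM /=.
  by apply: measurable_funB; apply: measurable_funM.
apply: (@measurable_partial_integral (fun z => complex.Im (cis (fourier_phase z.1 z.2) * g z.2))).
under eq_fun do rewrite complex_ImM /=.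
by apply: measurable_funD; apply: measurable_funM.
Qed.

End FourierOperator.

Section TruncatedFourier.
Variable R : realType.
Notation C := R[i].
Implicit Types (f g h phi : R -> C) (A B : set R).

Lemma L2_bounded A phi (M : R) : lebesgue_measurable A -> (leb A < +oo)%E ->
  cmeasurable phi -> (forall x, A x -> normsq (phi x) <= M) -> L2 (Defs.proj A phi).
Proof.
move=> mA fA mphi phiM; apply: (@L2_le _ _ (fun x => M * \1_A x)).
- exact: cmeasurable_proj.
- by apply: lebesgue_integrableZ; exact: indic_lebesgue_integrable.
- move=> x; rewrite /Defs.proj indicE; case: ifPn => [/set_mem Ax|_] /=.
    by rewrite mulr1 phiM.
  by rewrite mulr0 /normsq /= expr0n addr0.
Qed.

Definition fourier_char (xi x : R) : C := conjc (cis (fourier_phase xi x)).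

(** The operator [K] with the Fourier integral written as an inner product with a character cut off
    to [A]: for each xi, Hilbert space geometry in x becomes available. *)
Definition truncated_fourier A B f : R -> C :=
  Defs.proj B (fun xi => inner f (Defs.proj A (fourier_char xi))).

Lemma K_truncated_fourier A B (c : R) f :
  K A B c f = truncated_fourier A (dilate c B) f.
Proof.
apply/funext => xi; rewrite /K /truncated_fourier /Defs.proj /fourier /inner.
case: ifP => // _; congr (cint _ _); apply/funext => x.
case: ifP => _; last by rewrite rmorph0 !mulr0.
by rewrite /fourier_char conjcK mulrC.
Qed.

Lemma L2_fourier_char A (xi : R) : lebesgue_measurable A -> (leb A < +oo)%E ->
  L2 (Defs.proj A (fourier_char xi)).
Proof.
move=> mA fA; apply: (@L2_bounded _ _ 1 mA fA).
  by apply: cmeasurableJ; apply: measurable_cis; exact: measurable_fourier_phase.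
by move=> x _; rewrite normsqJ normsqE nrm_cis expr1n.
Qed.

Lemma normsq_proj A f x : normsq (Defs.proj A f x) = \1_A x * normsq (f x).
Proof.
rewrite /Defs.proj indicE; case: ifP => _; first by rewrite mul1r.
by rewrite mul0r /normsq /= expr0n addr0.
Qed.

End TruncatedFourier.

Section TruncatedFourierBound.
Variable R : realType.
Notation C := R[i].
Notation L := (lebesgue_type R).
Implicit Types (f g h phi : R -> C).
Variables (A B : set R).
Hypotheses (mA : lebesgue_measurable A) (mB : lebesgue_measurable B).
Hypotheses (fA : (leb A < +oo)%E) (fB : (leb B < +oo)%E).

Let charL2 (xi : R) := L2_fourier_char xi mA fA.

(** Equality holds at every point, because f enters only through inner products. It allows a change
    of representative inside the operator. *)
Lemma truncated_fourier_ae f g : L2 f -> L2 g -> ae_equal f g ->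
  truncated_fourier A B f = truncated_fourier A B g.
Proof.
move=> fL gL fg; rewrite /truncated_fourier; apply/funext => xi.
by rewrite !projE (inner_ael fL gL _ fg).
Qed.

Lemma cmeasurable_inner_char f : L2 f ->
  cmeasurable (fun xi => inner f (Defs.proj A (fourier_char xi))).
Proof.
move=> fL; rewrite (_ : (fun xi => _) = fourier (Defs.proj A f)).
  by apply: measurable_fourier; apply: cmeasurable_proj => //; exact: L2_cmeasurable.
apply/funext => xi; rewrite /fourier /inner; congr (cint _ _).
apply/funext => x; rewrite /Defs.proj; case: ifP => _; last by rewrite rmorph0 !mulr0.
by rewrite /fourier_char conjcK mulrC.
Qed.

(** Cauchy-Schwarz bounds the squared value at each xi by |f|^2 |A|, and B has finite measure. *)
Lemma L2_truncated_fourier f : L2 f -> L2 (truncated_fourier A B f).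
Proof.
move=> fL; apply: (@L2_bounded _ _ _ (L2normsq f * fine (leb A)) mB fB).
  exact: cmeasurable_inner_char.
move=> xi _; apply: (le_trans (inner_CauchySchwarz fL (charL2 xi))).
rewrite ler_wpM2l ?L2normsq_ge0// /L2normsq.
rewrite (_ : lint _ _ = leb A)// /lint.
under eq_integral do rewrite normsq_proj normsqJ normsqE nrm_cis expr1n mulr1.
by rewrite integral_indic// setIT.
Qed.

Lemma lint_proj_normsq f :
  lint setT (fun x => (normsq (Defs.proj A f x))%:E) = lint A (fun x => (normsq (f x))%:E).
Proof.
rewrite /lint [RHS]integral_mkcond; apply: eq_integral => x _.
rewrite normsq_proj /patch indicE; case: ifP => _; first by rewrite mul1r.
by rewrite mul0r.
Qed.

(** Tonelli on the whole plane, the two domains being absorbed into the integrand as indicators. *)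
Lemma lint_swap (F : L * L -> R) : measurable_fun setT F -> (forall z, 0 <= F z) ->
  lint A (fun x => lint B (fun xi => (F (x, xi))%:E)) =
  lint B (fun xi => lint A (fun x => (F (x, xi))%:E)).
Proof.
move=> mF F0; pose H (z : L * L) : \bar R := (\1_A z.1 * \1_B z.2 * F z)%:E.
have m1 : measurable_fun setT (fun x : L => \1_A x : R) by exact: measurable_indic.
have m2 : measurable_fun setT (fun x : L => \1_B x : R) by exact: measurable_indic.
have mH : measurable_fun setT H.
  apply/measurable_EFinP; apply: measurable_funM; last exact: mF.
  apply: measurable_funM.
    exact: (measurableT_comp m1 measurable_fst).
  exact: (measurableT_comp m2 measurable_snd).
have H0 z : (0 <= H z)%E by rewrite lee_fin !mulr_ge0.
have := @fubini_tonelli _ _ L L R leb leb H mH H0.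
rewrite /lint [X in _ -> X = _]integral_mkcond [X in _ -> _ = X]integral_mkcond.
congr (_ = _); apply: eq_integral => x _; rewrite /patch; case: ifPn => xA.
- rewrite [RHS]integral_mkcond; apply: eq_integral => y _.
  by rewrite /H /patch /= indicE xA mul1r indicE; case: ifP => _; rewrite ?mul1r ?mul0r.
- by rewrite integral0_eq// => y _; rewrite /H /= indicE (negPf xA) !mul0r.
- rewrite [RHS]integral_mkcond; apply: eq_integral => y _.
  rewrite /H /patch /= mulrAC (@indicE _ _ B) xA mulr1 indicE.
  by case: ifP => _; rewrite ?mul1r ?mul0r.
- by rewrite integral0_eq// => y _; rewrite /H /= (@indicE _ _ B) (negPf xA) mulr0 mul0r.
Qed.

Lemma measurable_lint_section (F : L * L -> R) :
  measurable_fun setT F -> (forall z, 0 <= F z) ->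
  measurable_fun setT (fun xi : L => lint A (fun x => (F (x, xi))%:E)).
Proof.
move=> mF F0; pose H (z : L * L) : \bar R := (\1_A z.1 * F z)%:E.
have m1 : measurable_fun setT (fun x : L => \1_A x : R) by exact: measurable_indic.
have mH : measurable_fun setT H.
  apply/measurable_EFinP; apply: measurable_funM; last exact: mF.
  exact: (measurableT_comp m1 measurable_fst).
have H0 z : (0 <= H z)%E by rewrite lee_fin mulr_ge0.
have := @measurable_fun_fubini_tonelli_G _ _ L L R leb H mH H0.
congr measurable_fun; apply/funext => xi; rewrite /fubini_G /lint [RHS]integral_mkcond.
apply: eq_integral => x _; rewrite /H /patch /= indicE.
by case: ifP => _; rewrite ?mul1r ?mul0r.
Qed.

End TruncatedFourierBound.

(** * Polynomial remainders of the Fourier kernel *)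

Section PolynomialRemainder.
Variable R : realType.
Notation C := R[i].
Implicit Types (p : {poly C}) (s : R).

Lemma horner_real_coef N p s : (size p <= N)%N ->
  p.[s%:C] = \sum_(k < N) p`_k * (s ^+ k)%:C.
Proof.
by move=> pN; rewrite (horner_coef_wide _ pN); apply: eq_bigr => k _; rewrite rmorphXn.
Qed.

Lemma measurable_horner p :
  measurable_fun setT (fun s : R => complex.Re p.[s%:C]) /\
  measurable_fun setT (fun s : R => complex.Im p.[s%:C]).
Proof.
split.
  rewrite (_ : (fun s => _) = fun s => \sum_(k < size p) complex.Re p`_k * s ^+ k).
    apply: measurable_sum => k; apply: measurable_funM; first exact: measurable_cst.
    exact: exprn_measurable.
  apply/funext => s; rewrite (horner_real_coef s (leqnn _)) raddf_sum /=.
  by apply: eq_bigr => k _; rewrite complex_ReM /= mulr0 subr0.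
rewrite (_ : (fun s => _) = fun s => \sum_(k < size p) complex.Im p`_k * s ^+ k).
  apply: measurable_sum => k; apply: measurable_funM; first exact: measurable_cst.
  exact: exprn_measurable.
apply/funext => s; rewrite (horner_real_coef s (leqnn _)) raddf_sum /=.
by apply: eq_bigr => k _; rewrite complex_ImM /= mulr0 add0r.
Qed.

Definition remainder p s : C := cis (- s) - p.[s%:C].

Lemma measurable_remainder p :
  measurable_fun setT (fun s : R => complex.Re (remainder p s)) /\
  measurable_fun setT (fun s : R => complex.Im (remainder p s)).
Proof.
have [m1 m2] := measurable_horner p.
have mopp : measurable_fun setT (fun s : R => - s) by exact: oppr_measurable.
split.
  under eq_fun do rewrite /remainder raddfB.
  apply: measurable_funB; last exact: m1.
  apply: (measurableT_comp _ mopp); apply: continuous_measurable_fun.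
  exact: continuous_cos.
under eq_fun do rewrite /remainder raddfB.
apply: measurable_funB; last exact: m2.
apply: (measurableT_comp _ mopp); apply: continuous_measurable_fun.
exact: continuous_sin.
Qed.

Lemma measurable_normsq_remainder p :
  measurable_fun setT (fun s : R => normsq (remainder p s)).
Proof.
have [m1 m2] := measurable_remainder p.
by apply: measurable_funD; apply: measurable_funX.
Qed.

Lemma remainder_bounded p (T : R) :
  exists M : R, forall s, `|s| <= T -> nrm (remainder p s) <= M.
Proof.
exists (1 + \sum_(k < size p) nrm p`_k * T ^+ k) => s sT.
have T0 : 0 <= T := le_trans (normr_ge0 s) sT.
rewrite (le_trans (nrmD _ _))// nrm_cis lerD2l nrmN.
rewrite (horner_real_coef s (leqnn _)) (le_trans (nrm_sum _ _ _))//.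
apply: ler_sum => k _; rewrite nrmM nrm_real normrX ler_wpM2l ?nrm_ge0//.
by rewrite lerXn2r// nnegrE.
Qed.

Variables (A B : set R) (alpha b : R).
Hypotheses (mA : lebesgue_measurable A) (mB : lebesgue_measurable B).
Hypotheses (fA : (leb A < +oo)%E) (fB : (leb B < +oo)%E) (bA : bounded_set A).

Definition centred_phase (x xi : R) : R := 2 * pi * (x - alpha) * (xi - b).

(* Up to a constant factor, exp(2 i pi x xi) is exp(2 i pi b x) times the
   exponential of the centred phase: replacing the latter by the conjugate of [p]
   contributes combinations of these [N] functions of [x], whatever [xi]. *)
Definition twisted_monomial k (x : R) : C :=
  conjc (cis (- (2 * pi * b * x)) * ((x - alpha) ^+ k)%:C).

Let lm_affine (u v : R) : lebesgue_measurable_fun (fun x => u * x + v).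
Proof.
apply: borel_lebesgue_measurable_fun; apply: measurable_funD.
  exact: mulrl_measurable.
exact: measurable_cst.
Qed.

Let lm_twist : lebesgue_measurable_fun (fun x => - (2 * pi * b * x)).
Proof.
by have := lm_affine (- (2 * pi * b)) 0; under eq_fun do rewrite addr0 mulNr.
Qed.

Lemma L2_twisted_monomial k : L2 (Defs.proj A (twisted_monomial k)).
Proof.
have [M M0 AM] := bounded_setP bA.
apply: (@L2_bounded _ _ _ (((M + `|alpha|) ^+ k) ^+ 2) mA fA).
  apply: cmeasurableJ; apply: cmeasurableM; first exact: measurable_cis.
  split => /=; last exact: measurable_cst.
  apply: measurable_funX; have := lm_affine 1 (- alpha).
  by under eq_fun do rewrite mul1r.
move=> x Ax; rewrite normsqJ normsqM normsqE nrm_cis expr1n mul1r normsqE nrm_real.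
have Ma : `|x - alpha| <= M + `|alpha|.
  by rewrite (le_trans (ler_normB _ _))// lerD2r AM.
have Ma0 : 0 <= M + `|alpha| by rewrite addr_ge0// ltW.
by rewrite normrX lerXn2r ?nnegrE ?exprn_ge0// lerXn2r ?nnegrE.
Qed.

(** Carries the twist and the conjugation of [twisted_monomial], so that both can be second
    arguments of [inner]; its modulus is that of [remainder]. *)
Definition twisted_remainder p xi (x : R) : C :=
  conjc (cis (- (2 * pi * b * x)) * remainder p (centred_phase x xi)).

Lemma L2_twisted_remainder p xi : L2 (Defs.proj A (twisted_remainder p xi)).
Proof.
have [M M0 AM] := bounded_setP bA.
have [M1 pM1] := remainder_bounded p (2 * pi * (M + `|alpha|) * `|xi - b|).
apply: (@L2_bounded _ _ _ (M1 ^+ 2) mA fA).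
  have mph : lebesgue_measurable_fun (fun x => centred_phase x xi).
    have := lm_affine (2 * pi * (xi - b)) (- (2 * pi * alpha * (xi - b))).
    congr lebesgue_measurable_fun; apply/funext => x.
    by rewrite /centred_phase; ring.
  apply: cmeasurableJ; apply: cmeasurableM; first exact: measurable_cis.
  have [m1 m2] := measurable_remainder p.
  by split; [exact: (measurableT_comp m1 mph)|exact: (measurableT_comp m2 mph)].
move=> x Ax; rewrite normsqJ normsqM normsqE nrm_cis expr1n mul1r normsqE.
have Ma : `|x - alpha| <= M + `|alpha|.
  by rewrite (le_trans (ler_normB _ _))// lerD2r AM.
have phM : `|centred_phase x xi| <= 2 * pi * (M + `|alpha|) * `|xi - b|.
  have pi2 : 0 <= 2 * pi :> R by rewrite mulr_ge0// pi_ge0.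
  rewrite /centred_phase normrM ler_wpM2r// normrM (ger0_norm pi2).
  exact: ler_wpM2l.
have := pM1 _ phM => r1.
by rewrite lerXn2r ?nnegrE ?nrm_ge0// (le_trans (nrm_ge0 _) r1).
Qed.

Lemma inner_fourier_char N p xi (f : R -> C) : (size p <= N)%N -> L2 f ->
  (forall k : 'I_N, inner f (Defs.proj A (twisted_monomial k)) = 0) ->
  normsq (inner f (Defs.proj A (fourier_char xi))) =
  normsq (inner f (Defs.proj A (twisted_remainder p xi))).
Proof.
move=> pN fL f0.
(* From x xi = (x - alpha) (xi - b) + b x + alpha xi - alpha b: the terms free of x form the
   unimodular [u], and b x is the twist. The coefficients [q] collect the dependence of p(t) on
   xi. *)
pose u : C := conjc (cis (2 * pi * alpha * b - 2 * pi * alpha * xi)).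
pose q (k : 'I_N) : C := u * conjc (p`_k * ((2 * pi * (xi - b)) ^+ k)%:C).
have charE : Defs.proj A (fourier_char xi) = fun x =>
    u * Defs.proj A (twisted_remainder p xi) x +
    \sum_k q k * Defs.proj A (twisted_monomial k) x.
  apply/funext => x; rewrite !projE.
  under eq_bigr do rewrite projE mulrCA.
  rewrite -mulr_sumr [u * _]mulrCA -mulrDr; congr (_ * _).
  have -> : fourier_char xi x =
      u * conjc (cis (- (2 * pi * b * x)) * cis (- centred_phase x xi)).
    rewrite /u /fourier_char -rmorphM; congr conjc.
    have cisD (s t : R) : cis s * cis t = cis (s + t).
      by apply: complex_ext; rewrite ?complex_ReM ?complex_ImM /= ?cosD ?sinD; ring.
    by rewrite !cisD; congr cis; rewrite /fourier_phase /centred_phase; ring.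
  rewrite /twisted_remainder /remainder.
  have -> : \sum_k q k * twisted_monomial k x =
      u * conjc (cis (- (2 * pi * b * x)) * p.[(centred_phase x xi)%:C]).
    rewrite (horner_real_coef _ pN) mulr_sumr rmorph_sum mulr_sumr.
    apply: eq_bigr => k _; rewrite /q /twisted_monomial -mulrA; congr (_ * _).
    rewrite -rmorphM; congr conjc.
    have -> : centred_phase x xi ^+ k = (2 * pi * (xi - b)) ^+ k * (x - alpha) ^+ k.
      by rewrite -exprMn; congr (_ ^+ _); rewrite /centred_phase; ring.
    by rewrite [in RHS]rmorphM /=; ring.
  by rewrite -mulrDr -rmorphD -mulrDr subrK.
have rL := L2_twisted_remainder p xi.
have mL k : L2 (Defs.proj A (twisted_monomial k)) := L2_twisted_monomial k.
rewrite charE innerZDr//; last by apply: L2_sum => k; exact: mL.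
rewrite inner_sumr//.
rewrite big1 ?addr0; last by move=> k _; rewrite f0 mulr0.
by rewrite normsqM normsqJ normsqJ normsqE nrm_cis expr1n mul1r.
Qed.

End PolynomialRemainder.

Section OrthonormalRemainder.
Variable R : realType.
Notation C := R[i].
Notation L := (lebesgue_type R).
Variables (A B : set R) (alpha b : R).
Hypotheses (mA : lebesgue_measurable A) (mB : lebesgue_measurable B).
Hypotheses (fA : (leb A < +oo)%E) (fB : (leb B < +oo)%E) (bA : bounded_set A).

Definition remainder_energy (p : {poly C}) : \bar R :=
  lint A (fun x => lint B (fun xi =>
    (normsq (remainder p (centred_phase alpha b x xi)))%:E)).

Lemma measurable_centred_phase :
  measurable_fun setT (fun z : L * L => centred_phase alpha b z.1 z.2).
Proof.
have aff (v : R) : lebesgue_measurable_fun (fun x => x - v).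
  apply: borel_lebesgue_measurable_fun; apply: measurable_funB => //.
apply: measurable_funM.
  apply: measurable_funM; first exact: measurable_cst.
  exact: (measurableT_comp (aff alpha) measurable_fst).
exact: (measurableT_comp (aff b) measurable_snd).
Qed.

Lemma measurable_normsq_remainder_phase (p : {poly C}) :
  measurable_fun setT
    (fun z : L * L => normsq (remainder p (centred_phase alpha b z.1 z.2))).
Proof.
exact: (measurableT_comp (measurable_normsq_remainder p) measurable_centred_phase).
Qed.

Lemma truncated_fourier_energy N (p : {poly C}) d (e : 'I_d -> R -> C) :
  (size p <= N)%N -> (forall i, L2 (e i)) ->
  (forall i j, inner (e i) (e j) = (i == j)%:R) ->
  (forall i (k : 'I_N), inner (e i) (Defs.proj A (twisted_monomial alpha b k)) = 0) ->
  ((\sum_i L2normsq (truncated_fourier A B (e i)))%:E <= remainder_energy p)%E.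
Proof.
move=> pN eL on mom.
(* With xi outermost, Bessel's inequality in x can be applied under the integral. *)
rewrite /remainder_energy (lint_swap mA mB (measurable_normsq_remainder_phase p)); last first.
  by move=> z; exact: normsq_ge0.
have mi i : cmeasurable (fun xi => inner (e i) (Defs.proj A (fourier_char xi))).
  exact: cmeasurable_inner_char.
have -> : (\sum_i L2normsq (truncated_fourier A B (e i)))%:E =
    lint B (fun xi => \sum_i (normsq (inner (e i) (Defs.proj A (fourier_char xi))))%:E)%E.
  rewrite -sumEFin /lint ge0_integral_sum; last first.
  - by move=> i xi _; rewrite lee_fin normsq_ge0.
  - move=> i; apply/measurable_EFinP; apply: measurable_funTS.
    exact: measurable_normsq.
  - exact: mB.
  apply: eq_bigr => i _.
  by rewrite L2normsqE ?lint_proj_normsq//; exact: L2_truncated_fourier.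
apply: ge0_le_integral.
- exact: mB.
- by move=> xi _; rewrite sume_ge0// => i _; rewrite lee_fin normsq_ge0.
- apply: emeasurable_sum => i; apply/measurable_EFinP; apply: measurable_funTS.
  exact: measurable_normsq.
- apply: measurable_funTS.
  exact: (measurable_lint_section mA (measurable_normsq_remainder_phase p)
    (fun=> normsq_ge0 _)).
move=> xi _.
have -> : lint A (fun x => (normsq (remainder p (centred_phase alpha b x xi)))%:E) =
    (L2normsq (Defs.proj A (twisted_remainder alpha b p xi)))%:E.
  rewrite L2normsqE; last exact: L2_twisted_remainder.
  rewrite lint_proj_normsq; apply: eq_integral => x _.
  by rewrite /twisted_remainder normsqJ normsqM (normsqE (cis _)) nrm_cis expr1n mul1r.
rewrite sumEFin lee_fin.
rewrite (eq_bigr (fun i => normsq (inner (e i)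
    (Defs.proj A (twisted_remainder alpha b p xi))))); last first.
  by move=> i _; apply: inner_fourier_char pN (eL i) (mom i).
by apply: bessel_inequality => //; exact: L2_twisted_remainder.
Qed.

End OrthonormalRemainder.

(** * From spectral subspaces to the rank bound *)

Section KernelOrthonormal.
Variable C : numClosedFieldType.
Local Open Scope sesquilinear_scope.

(** Orthonormalisation in coordinates: [G] will be a Gram matrix, [T] the inner products with the
    vectors to be avoided, and the rows of [Q] the coefficients of the new family. The kernel of [T]
    has dimension n - rank T >= n - N. *)
Lemma kernel_orthonormal_basis n N (G : 'M[C]_n) (T : 'M[C]_(n, N)) :
  G ^t* = G -> (forall a : 'rV_n, a != 0 -> 0 < (a *m G *m a ^t*) 0 0) ->
  exists d, (n - N <= d)%N /\
    exists Q : 'M[C]_(d, n), Q *m T = 0 /\ Q *m G *m Q ^t* = 1%:M.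
Proof.
move=> Gh Gpos; exists (\rank (kermx T)); split.
  by rewrite mxrank_ker leq_sub2l// rank_leq_col.
have [M [Mf MT]] : exists M : 'M[C]_(\rank (kermx T), n), row_free M /\ M *m T = 0.
  exists (row_base (kermx T)); split; first exact: row_base_free.
  by apply/eqP; rewrite -sub_kermx eq_row_base.
have tcM m1 m2 m3 (X : 'M[C]_(m1, m2)) (Y : 'M[C]_(m2, m3)) :
    (X *m Y) ^t* = Y ^t* *m X ^t* by rewrite trmx_mul map_mxM.
pose G' := M *m G *m M ^t*.
have G'h : G' ^t* = G' by rewrite /G' !tcM Gh trmxCK mulmxA.
have G'n : G' \is normalmx by apply/normalmxP; rewrite G'h.
have G'E := orthomx_spectralP G'n.
pose P := spectralmx G'; pose sp := spectral_diag G'.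
have Pu : P \is unitarymx := spectral_unitarymx G'.
have PGP : P *m G' *m P ^t* = diag_mx sp.
  transitivity (P *m (invmx P *m diag_mx sp *m P) *m P ^t*); first by rewrite -G'E.
  rewrite !mulmxA mulmxV ?unitarymx_unit// mul1mx.
  by rewrite -mulmxA (unitarymxP Pu) mulmx1.
(* An eigenvalue is the value of the form [G] at a row of [P *m M], nonzero because both factors
   have independent rows. *)
have sp_gt0 i : 0 < sp 0 i.
  have -> : sp 0 i = (row i (P *m M) *m G *m (row i (P *m M)) ^t*) 0 0.
    transitivity ((P *m G' *m P ^t*) i i).
      by rewrite PGP mxE eqxx.
    have -> : P *m G' *m P ^t* = (P *m M) *m G *m (P *m M) ^t*.
      by rewrite tcM /G' !mulmxA.
    by rewrite -!row_mul !mxE; apply: eq_bigr => j _; rewrite !mxE.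
  apply: Gpos; apply/eqP; rewrite row_mul => /eqP.
  rewrite mulmx_free_eq0// => /eqP rP0.
  have := row_free_unit P; rewrite unitarymx_unit// => Pf.
  have : (delta_mx 0 i : 'rV[C]_(_)) *m P == 0 by rewrite -rowE rP0.
  rewrite mulmx_free_eq0// => /eqP /matrixP /(_ 0 i).
  by rewrite !mxE !eqxx => /eqP; rewrite oner_eq0.
pose D := diag_mx (\row_i (sqrtC (sp 0 i))^-1).
have Dh : D ^t* = D.
  rewrite /D tr_diag_mx map_diag_mx; congr diag_mx; apply/rowP => i.
  by rewrite !mxE; apply: geC0_conj; rewrite invr_ge0 sqrtC_ge0 ltW.
(* The rows of [P *m M] diagonalise [G] on the kernel of [T], and [D] normalises
   them. *)
exists (D *m (P *m M)); split; first by rewrite -!mulmxA MT !mulmx0.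
have -> : D *m (P *m M) *m G *m (D *m (P *m M)) ^t* = D *m (P *m G' *m P ^t*) *m D.
  by rewrite !tcM Dh /G' !mulmxA.
rewrite PGP /D !mulmx_diag; apply/matrixP => i j; rewrite !mxE.
case: eqVneq => [->|_]; last by rewrite mulr0n.
have r0 : sqrtC (sp 0 j) != 0 by rewrite sqrtC_eq0 gt_eqF.
have := sqrtCK (sp 0 j); rewrite !mulr1n.
by move: r0; move: (sqrtC (sp 0 j)); move: (sp 0 j) => s r r0 <-; field.
Qed.

End KernelOrthonormal.

Section SpectralSubspace.
Variable R : realType.
Notation C := R[i].
Implicit Types (f g h : R -> C).

Lemma conjC_conjc (z : C) : Num.conj z = conjc z.
Proof. by []. Qed.

(** The measure vanishes off the interval, where t - eps is positive; if the integral of t - eps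
    were 0, the interval would be null as well. *)
Lemma integral_gt_of_concentrated
    (nu : {finite_measure set (measurableTypeR R) -> \bar R}) (eps : R) :
  0 < fine (nu `]eps, 1 - eps[%classic) ->
  fine (nu setT) = fine (nu `]eps, 1 - eps[%classic) ->
  eps * fine (nu setT) < fine (\int[nu]_t t%:E)%E.
Proof.
set X := `]eps, 1 - eps[%classic => X0 XT.
have mX : measurable (X : set (measurableTypeR R)) by exact: measurable_itv.
have finnu (Y : set (measurableTypeR R)) : measurable Y -> nu Y \is a fin_num.
  by move=> mY; exact: fin_num_measure.
have XC0 : nu (~` X) = 0%E.
  have XTE : nu setT = (nu X + nu (~` X))%E.
    by rewrite -measureU ?setICr ?setUCr//; exact: measurableC.
  move: XT; rewrite XTE fineD ?finnu//; last exact: measurableC.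
  move=> /eqP; rewrite -subr_eq0 addrAC subrr add0r => /eqP XC.
  by rewrite -[LHS]fineK ?XC// finnu//; exact: measurableC.
have mid : measurable_fun setT (fun t : measurableTypeR R => t%:E : \bar R).
  by apply/measurable_EFinP; exact: measurable_id.
have -> : (\int[nu]_t t%:E = \int[nu]_(t in X) t%:E)%E.
  rewrite [RHS]integral_mkcond; apply: (ae_eq_integral _ _ measurableT).
  - exact: mid.
  - apply/(measurable_restrictT _ mX); exact: measurable_funTS.
  exists (~` X); split => //; first exact: measurableC.
  move=> t /= tX Xt; apply: tX => _; rewrite /patch mem_set//.
have intc (k : R) : nu.-integrable X (EFin \o (fun=> k)).
  exact: finite_measure_integrable_cst.
have inti : nu.-integrable X (EFin \o (fun t : R => t)).
  apply: (le_integrable mX _ _ (intc (`|eps| + `|1 - eps|))).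
    exact: measurable_funTS.
  move=> t; rewrite /X /= in_itv/= lee_fin => /andP[t1 t2].
  have M0 : 0 <= `|eps| + `|1 - eps| by rewrite addr_ge0.
  rewrite (ger0_norm M0) ler_norml.
  have := ler_norm (1 - eps); have := ler_norm (- eps); rewrite normrN.
  have := normr_ge0 eps; have := normr_ge0 (1 - eps) => n1 n2 n3 n4.
  by apply/andP; split; lra.
rewrite XT; suff : 0 < Rintegral nu X (fun t => t - eps).
  rewrite RintegralB// Rintegral_cst// subr_gt0; exact.
rewrite lt_def; apply/andP; split; last first.
  by apply: Rintegral_ge0 => t; rewrite /X /= in_itv/= subr_ge0 => /andP[/ltW].
apply/eqP => I0; move: X0; apply/negP; rewrite -leNgt.
suff -> : nu X = 0%E by [].
have mB : measurable_fun X (EFin \o (fun t : R => t - eps)).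
  apply/measurable_EFinP; apply: measurable_funTS.
  by apply: measurable_funB; [exact: measurable_id|exact: measurable_cst].
have : (\int[nu]_(t in X) `|(EFin \o (fun t : R => t - eps)%R) t| = 0)%E.
  transitivity (\int[nu]_(t in X) (t - eps)%R%:E)%E.
    apply: eq_integral => t; rewrite inE /X /= in_itv/= => /andP[t1 _].
    by rewrite ger0_norm// subr_ge0 ltW.
  rewrite -[LHS]fineK; first by rewrite -/(Rintegral nu X (fun t => t - eps)) I0.
  apply: (integrable_fin_num mX).
  by have := integrableB mX inti (intc eps); congr (integrable _ _ _).
move/(ae_eq_integral_abs nu mX mB) => [N [mN N0 sub]].
apply/eqP; rewrite -measure_le0 -N0; apply: le_measure; rewrite ?inE//.
move=> t Xt; apply: sub => /= /(_ Xt) [] /eqP.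
by move: Xt; rewrite /X /= in_itv/= subr_eq0 => /andP[/gt_eqF -> _].
Qed.

End SpectralSubspace.

Section SpectralProjection.
Variable R : realType.
Notation C := R[i].
Implicit Types (f g h : R -> C).
Variables (T Tstar : operator R) (E : set R -> operator R).
Hypothesis TL2 : forall f, L2 f -> L2 (T f).
Hypothesis adjT : is_adjoint T Tstar.
Hypothesis spE : spectral_measure_of (fun f => Tstar (T f)) E.

Lemma spectral_setII (X : set R) h : measurable X -> L2 h ->
  ae_equal (E X (E X h)) (E X h).
Proof.
move=> mX hL; have := spectral_setI spE mX mX hL; rewrite setIid.
by apply: (@filterS _ _ (ae_filter_ringOfSetsType leb)) => x ->.
Qed.

(* The scalar spectral measure of [w] is concentrated on ]eps, 1 - eps[, and its
   integral of t is the squared norm of [T w]. *)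
Lemma spectral_gap (eps : R) h (w := E `]eps, 1 - eps[%classic h) :
  L2 h -> 0 < L2normsq w -> eps * L2normsq w < L2normsq (T w).
Proof.
set X := `]eps, 1 - eps[%classic in w * => hL w0.
have mX : measurable (X : set R) by exact: measurable_itv.
have wL : L2 w by exact: (spectral_L2 spE).
have [nu [nuE nuint]] := spectral_integral spE wL.
have nuX : fine (nu X) = L2normsq w.
  apply: (@complexI R); rewrite -nuE// -inner_self//; apply: inner_ael => //.
    exact: (spectral_L2 spE).
  exact: spectral_setII.
have nuT : fine (nu setT) = L2normsq w.
  apply: (@complexI R); rewrite -nuE// -inner_self//; apply: inner_ael => //.
    exact: (spectral_L2 spE).
  exact: (spectral_setT spE).
have -> : L2normsq (T w) = fine (\int[nu]_t t%:E)%E.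
  apply: (@complexI R); rewrite -nuint -inner_self; last exact: TL2.
  have TTL : L2 (Tstar (T w)) by apply: (proj1 adjT); exact: TL2.
  (* [is_adjoint] moves the operator out of the left argument, whereas the spectral integral has it
     there; the conjugation disappears since the value is real. *)
  have -> : inner (Tstar (T w)) w = conjc (inner w (Tstar (T w))) by exact: innerC.
  by rewrite -(proj2 adjT w (T w) wL (TL2 wL)) inner_self ?conjc_real//; exact: TL2.
by rewrite -nuT; apply: integral_gt_of_concentrated; rewrite nuX.
Qed.

Lemma spectral_sum (X : set R) n (a : 'I_n -> C) (f : 'I_n -> R -> C) :
  measurable X -> (forall i, L2 (f i)) ->
  ae_equal (E X (fun x => \sum_i a i * f i x)) (fun x => \sum_i a i * E X (f i) x).
Proof.
move=> mX fL.
(* Linearity in the form a f + g, with a = -1 and both functions 0, yields E 0 = - E 0 + E 0. *)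
have E0 : ae_equal (E X (fun=> 0)) (fun=> 0).
  have := spectral_linear spE (-1) mX (@L20 R) (@L20 R).
  rewrite (_ : (fun x : R => -1 * 0 + 0) = (fun=> 0)); last first.
    by apply/funext => x; rewrite mulr0 addr0.
  apply: (@filterS _ _ (ae_filter_ringOfSetsType leb)) => x ->.
  by rewrite mulN1r addNr.
elim: (index_enum _) => [|i s ih].
  rewrite (_ : (fun x => \sum_(i <- [::]) a i * f i x) = (fun=> 0)); last first.
    by apply/funext => x; rewrite big_nil.
  move: E0; apply: (@filterS _ _ (ae_filter_ringOfSetsType leb)) => x /= ->.
  by rewrite big_nil.
rewrite (_ : (fun x => \sum_(j <- i :: s) a j * f j x) =
    (fun x => a i * f i x + \sum_(j <- s) a j * f j x)); last first.
  by apply/funext => x; rewrite big_cons.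
move: (spectral_linear spE (a i) mX (fL i) (L2_sum s a fL)) ih.
apply: (@filterS2 _ _ (ae_filter_ringOfSetsType leb)) => x /=.
by rewrite big_cons => -> ->.
Qed.

End SpectralProjection.

Section OrthonormalFamily.
Variable R : realType.
Notation C := R[i].

(** Independence modulo null functions makes the Gram matrix positive definite, since its quadratic
    form is the squared norm of the combination. *)
Lemma orthonormal_annihilated n N (g : 'I_n -> R -> C) (w : 'I_N -> R -> C) :
  (forall i, L2 (g i)) -> (forall k, L2 (w k)) ->
  (forall a : 'I_n -> C,
    ae_equal (fun x => \sum_i a i * g i x) (fun=> 0) -> forall i, a i = 0) ->
  exists d, (n - N <= d)%N /\ exists Q : 'M[C]_(d, n),
    (forall i j, inner (fun x => \sum_k Q i k * g k x)
                       (fun x => \sum_k Q j k * g k x) = (i == j)%:R) /\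
    (forall i k, inner (fun x => \sum_j Q i j * g j x) (w k) = 0).
Proof.
move=> gL wL indep.
pose G : 'M[C]_n := \matrix_(i, j) inner (g i) (g j).
pose T : 'M[C]_(n, N) := \matrix_(i, k) inner (g i) (w k).
have formE m1 m2 (P : 'M[C]_(m1, n)) (Q : 'M[C]_(m2, n)) i j :
    (P *m G *m map_mx Num.conj Q^T) i j =
    inner (fun x => \sum_k P i k * g k x) (fun x => \sum_k Q j k * g k x).
  rewrite inner_sumr//; last exact: L2_sum.
  rewrite mxE; apply: eq_bigr => k _; rewrite !mxE mulrC; congr (_ * _).
  by rewrite inner_suml//; apply: eq_bigr => l _; rewrite mxE.
have [||d [nd [Q [QT QG]]]] := @kernel_orthonormal_basis _ n N G T.
- by apply/matrixP => i j; rewrite !mxE conjC_conjc -innerC.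
- move=> a a0; rewrite formE inner_self; last exact: L2_sum.
  rewrite -[X in X < _](rmorph0 (real_complex R)) ltcR lt_def L2normsq_ge0 andbT.
  apply/eqP => s0; move/eqP: a0; apply.
  apply/rowP => i; rewrite mxE; apply: (indep (fun i => a 0 i)).
  by apply: L2normsq_eq0 => //; exact: L2_sum.
exists d; split=> //; exists Q; split=> [i j|i k].
  by rewrite -formE QG mxE.
rewrite inner_suml//; transitivity ((Q *m T) i k); last by rewrite QT mxE.
by rewrite mxE; apply: eq_bigr => j _; rewrite mxE.
Qed.

End OrthonormalFamily.

Section Kappa.
Variable R : realType.
Implicit Types r s : R.

(** For r > 0, [kappa r] is the largest natural number strictly below r. *)
Lemma leq_kappa r (d : nat) : d%:R < r -> (d <= kappa r)%N.
Proof.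
move=> dr; rewrite /kappa.
have d1 : (d%:Z <= Num.ceil r - 1)%R.
  by rewrite lerBrDr lezD1 ceil_gt_int.
rewrite (max_idPr _); last exact: le_trans d1.
by rewrite -lez_nat gez0_abs//; exact: le_trans d1.
Qed.

Lemma le_kappa r s : r <= s -> (kappa r <= kappa s)%N.
Proof.
move=> rs; have max_ge0 (t : int) : 0 <= Num.max 0 t by rewrite le_max lexx.
by rewrite /kappa -lez_nat !gez0_abs// ge_max max_ge0 /= le_max lerD2r le_ceil// orbT.
Qed.

Lemma kappa_eq0 r : r <= 1 -> kappa r = 0%N.
Proof.
move=> r1; apply/eqP; rewrite /kappa absz_eq0; apply/eqP/max_idPl.
by rewrite subr_le0 -(ceil1 R) le_ceil.
Qed.

End Kappa.

Section RankBound.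
Variable R : realType.
Notation C := R[i].

Variables (A B : set R) (alpha b : R).
Hypotheses (mA : lebesgue_measurable A) (mB : lebesgue_measurable B).
Hypotheses (fA : (leb A < +oo)%E) (fB : (leb B < +oo)%E) (bA : bounded_set A).
Variables (Tstar : operator R) (E : set R -> operator R) (eps : R).
Hypothesis eps_gt0 : 0 < eps.
Hypothesis adjT : is_adjoint (truncated_fourier A B) Tstar.
Hypothesis spE : spectral_measure_of (fun f => Tstar (truncated_fourier A B f)) E.

Lemma Lambda_le_remainder_energy N (r : R) :
  (r%:E = ereal_inf [set remainder_energy A B alpha b p | p in
    [set p : {poly C} | (size p <= N)%N]])%E ->
  (Lambda eps E <= (N + kappa (r / eps))%:R%:E)%E.
Proof.
move=> rE; apply: ub_ereal_sup => _ [n [f fL indep] <-]; rewrite lee_fin ler_nat.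
set X := `]eps, 1 - eps[%classic in indep.
have mX : measurable (X : set R) by exact: measurable_itv.
pose g i := E X (f i).
have gL i : L2 (g i) by exact: (spectral_L2 spE).
pose w (k : 'I_N) := Defs.proj A (twisted_monomial alpha b k).
have wL k : L2 (w k) by exact: L2_twisted_monomial.
(* The orthonormal family does not depend on [p], so the strict inequality
   d eps < sum_i |T e_i|^2 survives the infimum over [p], attained or not. *)
have [d [nd [Q [on ann]]]] := orthonormal_annihilated gL wL indep.
rewrite (leq_trans _ (_ : N + d <= _)%N)//; first by rewrite -leq_subLR.
(* An empty family is set apart: the strict inequality between the two sums below needs at least one
   term. *)
rewrite leq_add2l; have [->//|d0] := posnP d.
apply: leq_kappa; rewrite ltr_pdivlMr// -lte_fin.
pose e i := fun x => \sum_k Q i k * g k x.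
have eL i : L2 (e i) by exact: L2_sum.
pose tf := truncated_fourier A B.
apply: (@lt_le_trans _ _ (\sum_i L2normsq (tf (e i)))%:E); last first.
  rewrite rE; apply: le_ereal_inf_tmp => _ [p pN <-].
  exact: (@truncated_fourier_energy _ _ _ _ _ mA mB fA fB bA N).
rewrite lte_fin.
have -> : d%:R * eps = \sum_(i < d) eps by rewrite sumr_const card_ord mulr_natl.
have lt1 i : eps < L2normsq (tf (e i)).
  have hL : L2 (fun x => \sum_k Q i k * f k x) by exact: L2_sum.
  (* [e i] is a combination of projected vectors and equals [v], a projected combination, only
     almost everywhere; the spectral gap is applied to [v]. *)
  pose v := E X (fun x => \sum_k Q i k * f k x).
  have vL : L2 v by exact: (spectral_L2 spE).
  have ve : ae_equal v (e i) := spectral_sum spE (Q i) mX fL.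
  have e1 : L2normsq (e i) = 1.
    by apply: (@complexI R); rewrite -inner_self// on eqxx.
  have v1 : L2normsq v = 1 by rewrite (L2normsq_ae vL (eL i) ve).
  have := @spectral_gap _ _ _ _ (L2_truncated_fourier mA mB fA fB) adjT spE eps _ hL.
  rewrite -/X -/v v1 mulr1 ltr01 => /(_ isT).
  by rewrite /tf (truncated_fourier_ae B mA fA vL (eL i) ve).
case: d d0 Q on ann e eL lt1 {nd} => // d _ Q on ann e eL lt1.
rewrite [X in X < _]big_ord_recl [X in _ < X]big_ord_recl ltr_leD//.
by apply: ler_sum => i _; exact: ltW.
Qed.

End RankBound.

(** * Bounds on the polynomial remainder *)

Section EnergyBounds.
Variable R : realType.
Notation C := R[i].
Notation L := (lebesgue_type R).
Variables (A B : set R) (alpha b : R).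
Hypotheses (mA : lebesgue_measurable A) (mB : lebesgue_measurable B).
Hypotheses (fA : (leb A < +oo)%E) (fB : (leb B < +oo)%E).
Implicit Types p : {poly C}.

Let mF p := measurable_normsq_remainder_phase alpha b p.

Let measurable_inner p : measurable_fun setT (fun x : L => lint B (fun xi =>
  (normsq (remainder p (centred_phase alpha b x xi)))%:E)).
Proof.
have mS : measurable_fun setT (fun z : L * L =>
    normsq (remainder p (centred_phase alpha b z.2 z.1))).
  exact: (measurableT_comp (mF p) (measurable_fun_pair measurable_snd measurable_fst)).
exact: (measurable_lint_section mB mS (fun=> normsq_ge0 _)).
Qed.

Let measurable_outer p (x : L) : measurable_fun setT (fun xi : L =>
  (normsq (remainder p (centred_phase alpha b x xi)))%:E).
Proof. by apply/measurable_EFinP; exact: (measurableT_comp (mF p) (pair1_measurable x)). Qed.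

(** The bound is asked for almost every x, then almost every xi, because essential centres control
    the sets only up to null sets. *)
Lemma remainder_energy_le_sup p (k : R) : 0 <= k ->
  (\forall x \ae leb, A x -> \forall xi \ae leb, B xi ->
    nrm (remainder p (centred_phase alpha b x xi)) <= k) ->
  (remainder_energy A B alpha b p <= (k ^+ 2)%:E * (leb A * leb B))%E.
Proof.
move=> k0 pk.
have -> : ((k ^+ 2)%:E * (leb A * leb B) = lint A (fun=> (k ^+ 2)%:E * leb B))%E.
  by rewrite /lint integral_cst// -muleA [(leb B * _)%E]muleC.
apply: ae_ge0_le_integral.
- exact: mA.
- by move=> x _; apply: integral_ge0 => xi _; rewrite lee_fin normsq_ge0.
- by apply: measurable_funTS; exact: measurable_inner.
- by move=> x _; rewrite mule_ge0// lee_fin sqr_ge0.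
- exact: measurable_cst.
move: pk; apply: (@filterS _ _ (ae_filter_ringOfSetsType leb)) => x + Ax => /(_ Ax) pk.
have -> : ((k ^+ 2)%:E * leb B = lint B (fun=> (k ^+ 2)%:E))%E.
  by rewrite /lint integral_cst.
apply: ae_ge0_le_integral.
- exact: mB.
- by move=> xi _; rewrite lee_fin normsq_ge0.
- by apply: measurable_funTS; exact: measurable_outer.
- by move=> xi _; rewrite lee_fin sqr_ge0.
- exact: measurable_cst.
move: pk; apply: (@filterS _ _ (ae_filter_ringOfSetsType leb)) => xi + Bxi => /(_ Bxi) pk.
by rewrite lee_fin normsq_le_sqr.
Qed.

Lemma remainder_energy_le_prod p (k : R) (u v : R -> R) : 0 <= k ->
  lebesgue_measurable_fun u -> lebesgue_measurable_fun v ->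
  (forall x, 0 <= u x) -> (forall x, 0 <= v x) ->
  (forall x xi, normsq (remainder p (centred_phase alpha b x xi)) <= k * u x * v xi) ->
  (remainder_energy A B alpha b p <=
   k%:E * (lint A (fun x => (u x)%:E) * lint B (fun xi => (v xi)%:E)))%E.
Proof.
move=> k0 mu mv u0 v0 puv.
have muE : measurable_fun setT (fun x : L => (u x)%:E) by exact/measurable_EFinP.
have mvE : measurable_fun setT (fun x : L => (v x)%:E) by exact/measurable_EFinP.
set V := lint B _.
have V0 : (0 <= V)%E by apply: integral_ge0 => xi _; rewrite lee_fin.
have -> : (k%:E * (lint A (fun x => (u x)%:E) * V) =
    lint A (fun x => (k%:E * V) * (u x)%:E))%E.
  rewrite /lint ge0_integralZl.
  - by rewrite -muleA [(V * _)%E]muleC.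
  - exact: mA.
  - exact: measurable_funTS.
  - by move=> x _; rewrite lee_fin.
  - by rewrite mule_ge0.
apply: ge0_le_integral.
- exact: mA.
- by move=> x _; apply: integral_ge0 => xi _; rewrite lee_fin normsq_ge0.
- by apply: measurable_funTS; exact: measurable_inner.
- by apply: measurable_funTS; exact: measurable_funeM.
move=> x _.
have -> : ((k%:E * V) * (u x)%:E = lint B (fun xi => (k * u x)%:E * (v xi)%:E))%E.
  rewrite /lint ge0_integralZl.
  - by rewrite EFinM muleAC.
  - exact: mB.
  - exact: measurable_funTS.
  - by move=> xi _; rewrite lee_fin.
  - by rewrite lee_fin mulr_ge0.
apply: ge0_le_integral.
- exact: mB.
- by move=> xi _; rewrite lee_fin normsq_ge0.
- by apply: measurable_funTS; exact: measurable_outer.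
- by apply: measurable_funTS; exact: measurable_funeM.
by move=> xi _; rewrite -EFinM lee_fin.
Qed.

Lemma remainder_energy_ge0 p : (0 <= remainder_energy A B alpha b p)%E.
Proof.
apply: integral_ge0 => x _; apply: integral_ge0 => xi _.
by rewrite lee_fin normsq_ge0.
Qed.

Lemma remainder_energy_inf N : exists2 r : R, 0 <= r &
  (r%:E = ereal_inf [set remainder_energy A B alpha b p | p in
    [set p : {poly C} | (size p <= N)%N]])%E.
Proof.
set i := ereal_inf _.
have i0 : (0 <= i)%E.
  by apply: le_ereal_inf_tmp => _ [p _ <-]; exact: remainder_energy_ge0.
have ioo : (i < +oo)%E.
  have zp : (size (0 : {poly C})%R <= N)%N by rewrite size_poly0.
  apply: (@le_lt_trans _ _ (remainder_energy A B alpha b (0 : {poly C})%R)).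
    by apply: ereal_inf_lbound; exists (0 : {poly C})%R.
  apply: (@le_lt_trans _ _ ((1 ^+ 2)%:E * (leb A * leb B))%E).
    apply: remainder_energy_le_sup => //; apply: nearW => x _; apply: nearW => xi _.
    by rewrite /remainder horner0 subr0 nrm_cis.
  by rewrite expr1n mul1e -ge0_fin_numE ?mule_ge0// fin_numM// ge0_fin_numE.
have ifin : i \is a fin_num by rewrite ge0_fin_numE.
by exists (fine i); [exact: fine_ge0|rewrite fineK].
Qed.

End EnergyBounds.

Section SquaredConstants.
Variable R : realType.

Lemma square_taylor_bound N (a u v d : R) :
  ((a * u * v) ^+ N / d) ^+ 2 = (a ^+ N / d) ^+ 2 * u ^+ (2 * N) * v ^+ (2 * N).
Proof.
rewrite [(2 * N)%N]mulnC !exprM !exprMn.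
by move: (a ^+ N) (u ^+ N) (v ^+ N) (d^-1) => x y z t; ring.
Qed.

(** The power c^(2N+1) comes from rescaling the moment over c B: c^(2N) from the integrand and c
    from the measure. Its root is the c^N sqrt(c) of [E_mom]. *)
Lemma square_E_mom N (a c d s u v w : R) : s ^+ 2 = c -> w ^+ 2 = u * v ->
  (a ^+ N / d) ^+ 2 * (u * (c ^+ (2 * N).+1 * v)) = ((a * c) ^+ N * s / d * w) ^+ 2.
Proof.
move=> sc wuv; have -> : c ^+ (2 * N).+1 = s ^+ 2 * (c ^+ N) ^+ 2.
  by rewrite exprS sc mulnC exprM.
rewrite [RHS]exprMn wuv [(a * c) ^+ N]exprMn.
by move: (a ^+ N) (c ^+ N) (d^-1) => x y z; ring.
Qed.

End SquaredConstants.

Section Minima.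

Lemma exists_is_least (P : nat -> Prop) : (exists n, P n) -> exists n, is_least P n.
Proof.
move=> [n Pn]; have ex : exists n, `[< P n >] by exists n; exact/asboolP.
exists (ex_minn ex); case: ex_minnP => m /asboolP Pm mmin.
by split=> // k Pk; apply: mmin; exact/asboolP.
Qed.

Lemma exists_is_min (F : nat -> nat) : exists n, is_min F n.
Proof. by apply: exists_is_least; exists (F 0%N), 0%N. Qed.

Lemma is_min_le (F G : nat -> nat) m n : (forall N, (F N <= G N)%N) ->
  is_min F m -> is_min G n -> (m <= n)%N.
Proof.
move=> FG [_ Fmin] [[N <-] _]; apply: leq_trans (FG N).
by apply: Fmin; exists N.
Qed.

End Minima.

(** * The polynomial remainder against [chi] and against the moments *)

Section RemainderEstimates.
Variable R : realType.
Notation C := R[i].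
Notation L := (lebesgue_type R).
Variables (A B : set R) (c : R).
Hypotheses (mA : lebesgue_measurable A) (mB : lebesgue_measurable B).
Hypotheses (bA : bounded_set A) (bB : bounded_set B).
Hypotheses (fA : (leb A < +oo)%E) (fB : (leb B < +oo)%E) (c_gt0 : 0 < c).

Let cB := dilate c B.
Let mcB : lebesgue_measurable cB := measurable_dilate c_gt0 mB.
Let fcB : (leb cB < +oo)%E.
Proof. by rewrite leb_dilate// lte_mul_pinfty// lee_fin ltW. Qed.

Lemma poly_remainder_ge0 N alpha beta : 0 <= poly_remainder A B c N alpha beta.
Proof. exact: sqrtr_ge0. Qed.

Lemma poly_remainder_sqr N alpha beta :
  ((poly_remainder A B c N alpha beta ^+ 2)%:E =
   ereal_inf [set remainder_energy A cB alpha (c * beta) p | p in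
     [set p : {poly C} | (size p <= N)%N]])%E.
Proof.
have [r r0 rE] := remainder_energy_inf alpha (c * beta) mA mcB fA fcB N.
rewrite -rE; congr EFin; rewrite sqr_sqrtr.
  by rewrite -[LHS]/(fine (ereal_inf [set remainder_energy A cB alpha (c * beta) p | p in
     [set p : {poly C} | (size p <= N)%N]])) -rE.
by rewrite -[X in 0 <= X]/(fine (ereal_inf [set remainder_energy A cB alpha (c * beta) p | p in
     [set p : {poly C} | (size p <= N)%N]])) -rE.
Qed.

Lemma poly_remainder_le N alpha beta (p : {poly C}) (k : R) : (size p <= N)%N -> 0 <= k ->
  (remainder_energy A cB alpha (c * beta) p <= (k ^+ 2)%:E)%E ->
  poly_remainder A B c N alpha beta <= k.
Proof.
move=> pN k0 pk; rewrite -(@ler_pXn2r _ 2)// ?nnegrE ?poly_remainder_ge0//.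
rewrite -lee_fin poly_remainder_sqr; apply: le_trans pk.
by apply: ereal_inf_lbound; exists p.
Qed.

Lemma poly_remainder_le_chi N alpha beta :
  is_ess_centre A alpha -> is_ess_centre B beta ->
  poly_remainder A B c N alpha beta <= Num.sqrt (c * vol A * vol B) *
    chi N (pi * c / 2 * diam_ess A * diam_ess B).
Proof.
move=> cA cB'; set zeta := _ * diam_ess B.
have dA0 := diam_ess_ge0 mA bA; have dB0 := diam_ess_ge0 mB bB.
have z0 : 0 <= zeta.
  by rewrite !mulr_ge0// ?pi_ge0// ltW.
have v0 (D : set R) : 0 <= vol D by exact: fine_ge0.
have [p pN pchi] := chi_approx N z0.
apply: (poly_remainder_le pN); first by rewrite mulr_ge0 ?sqrtr_ge0 ?chi_ge0.
have m0 : 0 <= c * vol A * vol B.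
  have c0 := ltW c_gt0.
  exact: (mulr_ge0 (mulr_ge0 c0 (v0 A)) (v0 B)).
rewrite exprMn sqr_sqrtr// EFinM.
have -> : ((c * vol A * vol B)%:E = leb A * leb cB)%E.
  rewrite leb_dilate// /vol !EFinM !fineK ?ge0_fin_numE//.
  by rewrite -muleA muleCA.
rewrite muleC; apply: remainder_energy_le_sup => //; first exact: chi_ge0.
(* The exceptional null set of [B] is dilated together with [B]. *)
have hB : \forall xi \ae leb, cB xi -> `|xi - c * beta| <= c * (diam_ess B / 2).
  have [N0 [mN N00 sub]] := ess_centre_ae mB bB cB'.
  exists (dilate c N0); split.
  - exact: measurable_dilate.
  - by rewrite leb_dilate// [X in (_ * X)%E](_ : _ = 0%E) ?mule0.
  - move=> _ /= /not_implyP[[y By <-] hy]; exists y => //; apply: sub => /= hyp.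
    apply: hy; rewrite -mulrBr normrM (gtr0_norm c_gt0) ler_pM2l//.
    exact: hyp.
move: (ess_centre_ae mA bA cA).
apply: (@filterS _ _ (ae_filter_ringOfSetsType leb)) => x + Ax => /(_ Ax) hx.
move: hB; apply: (@filterS _ _ (ae_filter_ringOfSetsType leb)) => xi + Bxi => /(_ Bxi) hxi.
apply: pchi; rewrite /centred_phase.
have pi2 : 0 <= 2 * pi :> R by rewrite mulr_ge0// pi_ge0.
rewrite !normrM -normrM (ger0_norm pi2).
(* The origin of zeta: 2 pi times half the diameter of A times half the diameter of c B bounds the
   phase. *)
have -> : zeta = 2 * pi * (diam_ess A / 2) * (c * (diam_ess B / 2)).
  by rewrite /zeta; field.
apply: ler_pM => //; first exact: mulr_ge0.
exact: (ler_wpM2l pi2 hx).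
Qed.

Lemma ereal_inf_minimizes (F : R -> \bar R) a : minimizes F a ->
  ereal_inf (range F) = F a.
Proof.
move=> Fmin; apply/eqP; rewrite eq_le; apply/andP; split.
  by apply: ereal_inf_lbound; exists a.
by apply: le_ereal_inf_tmp => _ [b _ <-].
Qed.

Lemma measurable_moment N (a : R) : lebesgue_measurable_fun (fun x => `|x - a| ^+ (2 * N)).
Proof.
apply: borel_lebesgue_measurable_fun; apply: measurable_funX.
apply: (measurableT_comp (@normr_measurable _ setT)).
by apply: measurable_funB; [exact: measurable_id|exact: measurable_cst].
Qed.

Lemma moment_ge0 (D : set R) N (a : R) : (0 <= moment D N a)%E.
Proof. by apply: integral_ge0 => x _; rewrite lee_fin exprn_ge0. Qed.

Lemma moment_fin (D : set R) N (a : R) : lebesgue_measurable D -> bounded_set D ->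
  (leb D < +oo)%E -> moment D N a \is a fin_num.
Proof.
move=> mD bD fD; have [M M0 DM] := bounded_setP bD.
rewrite ge0_fin_numE ?moment_ge0//.
apply: (@le_lt_trans _ _ (\int[leb]_(x in D) ((M + `|a|) ^+ (2 * N))%:E)%E).
  apply: ge0_le_integral.
  - exact: mD.
  - by move=> x _; rewrite lee_fin exprn_ge0.
  - by apply: measurable_funTS; apply/measurable_EFinP; exact: measurable_moment.
  - exact: measurable_cst.
  move=> x Dx; rewrite lee_fin lerXn2r ?nnegrE ?addr_ge0 ?(ltW M0)//.
  by rewrite (le_trans (ler_normB _ _))// lerD2r DM.
by rewrite integral_cst// lte_mul_pinfty// lee_fin exprn_ge0// addr_ge0// ltW.
Qed.

Lemma moment_dilate N beta :
  lint cB (fun xi => (`|xi - c * beta| ^+ (2 * N))%:E) =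
  ((c ^+ (2 * N).+1)%:E * moment B N beta)%E.
Proof.
have mf (a : R) : measurable_fun setT (fun x : L => (`|x - a| ^+ (2 * N))%:E).
  by apply/measurable_EFinP; exact: measurable_moment.
have f0 (x : R) : (0 <= (`|x - c * beta| ^+ (2 * N))%:E)%E.
  by rewrite lee_fin exprn_ge0.
rewrite (lint_dilate c_gt0 mB (mf _) f0) exprS EFinM -muleA; congr (_ * _)%E.
rewrite /moment /lint -ge0_integralZl.
- apply: eq_integral => x _; rewrite -EFinM -mulrBr normrM exprMn.
  by rewrite (gtr0_norm c_gt0).
- exact: mB.
- exact: measurable_funTS.
- by move=> x _; rewrite lee_fin exprn_ge0.
- by rewrite lee_fin exprn_ge0// ltW.
Qed.

Lemma poly_remainder_le_E_mom N alpha beta :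
  minimizes (moment A N) alpha -> minimizes (moment B N) beta ->
  poly_remainder A B c N alpha beta <= E_mom A B c N.
Proof.
move=> aN bN; rewrite /E_mom (ereal_inf_minimizes aN) (ereal_inf_minimizes bN).
have sN : (size (taylor_poly R N) <= N)%N by exact: size_poly.
have pi2 : 0 <= 2 * pi :> R by rewrite mulr_ge0// pi_ge0.
apply: (poly_remainder_le sN).
  rewrite mulr_ge0 ?sqrtr_ge0// divr_ge0// mulr_ge0 ?sqrtr_ge0//.
  by rewrite exprn_ge0// mulr_ge0// ltW.
have k0 : 0 <= ((2 * pi) ^+ N / N`!%:R) ^+ 2 :> R by exact: sqr_ge0.
apply: (le_trans (remainder_energy_le_prod mA mcB k0 (measurable_moment N alpha)
  (measurable_moment N (c * beta)) _ _ _)).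
- by move=> x; rewrite exprn_ge0.
- by move=> x; rewrite exprn_ge0.
- move=> x xi.
  have e := expi_taylor_le N (centred_phase alpha (c * beta) x xi).
  rewrite -horner_taylor_poly in e; apply: le_trans (normsq_le_sqr e) _.
  rewrite /centred_phase !normrM -normrM (ger0_norm pi2) square_taylor_bound.
  exact: lexx.
rewrite moment_dilate -/(moment A N alpha).
rewrite -(fineK (moment_fin N alpha mA bA fA)) -(fineK (moment_fin N beta mB bB fB)).
rewrite -!EFinM lee_fin; set w := Num.sqrt (fine _ * fine _).
have w2 : w ^+ 2 = fine (moment A N alpha) * fine (moment B N beta).
  by apply: sqr_sqrtr; apply: mulr_ge0; apply: fine_ge0; rewrite lee_fin fine_ge0 ?moment_ge0.
rewrite (square_E_mom N _ _ (sqr_sqrtr (ltW c_gt0)) w2).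
exact: lexx.
Qed.

End RemainderEstimates.

Theorem theorem4p6 (R : realType) (A B : set R) (c : R)
  (mA : lebesgue_measurable A) (mB : lebesgue_measurable B)
  (bA : bounded_set A) (bB : bounded_set B)
  (fA : (leb A < +oo)%E) (fB : (leb B < +oo)%E) (c_gt0 : 0 < c)
  (alpha0 beta0 : R)
  (halpha0 : is_ess_centre A alpha0) (hbeta0 : is_ess_centre B beta0)
  (alpha beta : nat -> R)
  (halpha : forall N, (1 <= N)%N -> minimizes (moment A N) (alpha N))
  (hbeta : forall N, (1 <= N)%N -> minimizes (moment B N) (beta N))
  (Kstar : operator R) (hKstar : is_adjoint (K A B c) Kstar)
  (E : set R -> operator R)
  (hE : spectral_measure_of (fun f => Kstar (K A B c f)) E) :
  let m := c * vol A * vol B in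
  let zeta := pi * c / 2 * diam_ess A * diam_ess B in
  let Rem N := Num.min (poly_remainder A B c N alpha0 beta0)
                       (poly_remainder A B c N (alpha N) (beta N)) in
  let Ehat N := Num.min (E_mom A B c N) (Num.sqrt m * chi N zeta) in
  (forall N, Rem N <= Ehat N <= Num.sqrt m * (zeta ^+ N / N`!%:R)) /\
  (forall eps : R, 0 < eps < 1 / 2 ->
    exists M1 M2 M3 Nfac : nat,
      [/\ is_min (fun N => (N + kappa (Rem N ^+ 2 / eps))%N) M1,
          is_min (fun N => (N + kappa (Ehat N ^+ 2 / eps))%N) M2,
          is_min (fun N => (N + kappa (m * chi N zeta ^+ 2 / eps))%N) M3
        & is_least (fun N =>
            Num.sqrt m * (zeta ^+ N / N`!%:R) <= Num.sqrt eps) Nfac] /\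
      [/\ (Lambda eps E <= M1%:R%:E)%E,
          (M1 <= M2 <= M3)%N
        & [/\ (M1 <= Nfac)%N, (M2 <= Nfac)%N & (M3 <= Nfac)%N]]).
Proof.
move=> m zeta Rem Ehat.
have v0 (D : set R) : 0 <= vol D by exact: fine_ge0.
have m0 : 0 <= m by exact: (mulr_ge0 (mulr_ge0 (ltW c_gt0) (v0 A)) (v0 B)).
have dA0 := diam_ess_ge0 mA bA; have dB0 := diam_ess_ge0 mB bB.
have z0 : 0 <= zeta by rewrite !mulr_ge0// ?pi_ge0// ltW.
(* At N = 0 the moment is the measure of D whatever the centre, so the arbitrary centre minimises it
   too. *)
have momentN D (a : nat -> R) : (forall N, (1 <= N)%N -> minimizes (moment D N) (a N)) ->
    forall N, minimizes (moment D N) (a N).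
  by move=> aN [|N]; [move=> b; rewrite /moment muln0|exact: aN].
(* The moment centres serve the bound by [E_mom], the essential centres the bound by [chi]. *)
have RemE N : Rem N <= Ehat N.
  rewrite le_min !ge_min; apply/andP; split; apply/orP; [right|left].
    exact: (poly_remainder_le_E_mom mA mB bA bB fA fB c_gt0
      (momentN _ _ halpha N) (momentN _ _ hbeta N)).
  exact: (poly_remainder_le_chi mA mB bA bB fA fB c_gt0 N halpha0 hbeta0).
have Rem0 N : 0 <= Rem N.
  by rewrite le_min; apply/andP; split; exact: poly_remainder_ge0.
have Ehat_chi N : Ehat N <= Num.sqrt m * chi N zeta by rewrite ge_min lexx orbT.
have chi_fac N : Num.sqrt m * chi N zeta <= Num.sqrt m * (zeta ^+ N / N`!%:R).
  by apply: ler_wpM2l; [exact: sqrtr_ge0|exact: chi_le].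
split=> [N|eps /andP[eps0 _]].
  by rewrite RemE (le_trans (Ehat_chi N)).
have [M1 M1min] := exists_is_min (fun N => (N + kappa (Rem N ^+ 2 / eps))%N).
have [M2 M2min] := exists_is_min (fun N => (N + kappa (Ehat N ^+ 2 / eps))%N).
have [M3 M3min] := exists_is_min (fun N => (N + kappa (m * chi N zeta ^+ 2 / eps))%N).
have [Nfac Nmin] : exists n, is_least (fun N =>
    Num.sqrt m * (zeta ^+ N / N`!%:R) <= Num.sqrt eps) n.
  apply: exists_is_least.
  have : Num.sqrt m * (zeta ^+ N / N`!%:R) @[N --> \oo] --> Num.sqrt m * 0.
    by apply: cvgMr; exact: cvg_exp_coeff.
  rewrite mulr0 => /cvgr_lt /(_ (Num.sqrt eps)); rewrite sqrtr_gt0 => /(_ eps0)[n _ nP].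
  by exists n; apply/ltW/nP => /=.
have sq_le (x y : R) : 0 <= x -> x <= y -> (kappa (x ^+ 2 / eps) <= kappa (y ^+ 2 / eps))%N.
  move=> x0 xy; apply: le_kappa; rewrite ler_pM2r ?invr_gt0// lerXn2r// nnegrE.
  exact: le_trans xy.
have M12 : (M1 <= M2)%N.
  by apply: is_min_le M1min M2min => N; rewrite leq_add2l sq_le.
have mchi N : m * chi N zeta ^+ 2 = (Num.sqrt m * chi N zeta) ^+ 2.
  by rewrite exprMn sqr_sqrtr.
have M23 : (M2 <= M3)%N.
  apply: is_min_le M2min M3min => N; rewrite leq_add2l mchi sq_le//.
  exact: le_trans (RemE N).
have M3fac : (M3 <= Nfac)%N.
  have [facP _] := Nmin; have [_] := M3min; apply.
  (* At [Nfac] the argument of [kappa] is at most 1, so the bracket equals [Nfac] and the minimum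
     cannot exceed it. *)
  exists Nfac; rewrite kappa_eq0 ?addn0//.
  rewrite ler_pdivrMr// mul1r mchi -[leRHS](sqr_sqrtr (ltW eps0)).
  rewrite lerXn2r ?nnegrE ?sqrtr_ge0 ?mulr_ge0 ?sqrtr_ge0 ?chi_ge0//.
  exact: le_trans (chi_fac _) facP.
have [M1fac M2fac] : (M1 <= Nfac)%N /\ (M2 <= Nfac)%N.
  by have M2fac := leq_trans M23 M3fac; split=> //; exact: leq_trans M12 M2fac.
exists M1, M2, M3, Nfac; split=> //; split; [|by rewrite M12|by split].
have [[N <-] _] := M1min.
have KE : K A B c = truncated_fourier A (dilate c B).
  by apply/funext => f; exact: K_truncated_fourier.
rewrite KE in hKstar hE.
have mcB := measurable_dilate c_gt0 mB.
have fcB : (leb (dilate c B) < +oo)%E.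
  by rewrite leb_dilate// lte_mul_pinfty// lee_fin ltW.
have bound a b : (Lambda eps E <=
    (N + kappa (poly_remainder A B c N a b ^+ 2 / eps))%:R%:E)%E.
  apply: (Lambda_le_remainder_energy mA mcB fA fcB bA eps0 hKstar hE).
  exact: (poly_remainder_sqr mA mB fA fB c_gt0).
(* [bound] holds for every pair of centres, in particular for the one with the smaller remainder. *)
by rewrite /Rem /Order.min; case: ifP => _; exact: bound.
Qed.
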